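(* Assume that the force matrix $\boldsymbol F$ is of class $C^2$ on $\mathcal V\times\mathcal E\times\mathcal V$ and that there exist $K_1, K_2 > 0$ such that for any $(v,e,x), (v',e',x') \in \mathcal{V}\times\mathcal{E}\times\mathcal{V}$, $$\|F^{1}(v,e,x)-F^{1}(v',e',x')\|_2 \le K_1\, |||(v-v',e-e',x-x')|||,$$ $$\|F^{tv}(v,e,x)-F^{tv}(v',e',x')\|_2 \le K_2\, |||(v-v',e-e',x-x')|||.$$ In addition, assume that there exist $K_3,K_4>0$ such that for any $w=(v,e,x),\ w'=(v',e',x')\in\mathcal V\times\mathcal E\times\mathcal V$, $$\|J_wF^1(w)\,\tilde F(w) - J_wF^1(w')\,\tilde F(w')\|_2\le K_3\,|||(v-v',e-e',x-x')|||,$$ $$\|J_wF^{tv}(w)\,\tilde F(w) - J_wF^{tv}(w')\,\tilde F(w')\|_2\le K_4\,|||(v-v',e-e',x-x')|||,$$ where $J_wF^1$ and $J_wF^{tv}$ are the Jacobian matrices of the vector-valued functions $F^1(w)$ and $F^{tv}(w)$, and $\tilde F$ denotes the lifted Euler update $$\tilde F(w) = \begin{pmatrix} -\Phi_v\widehat M_{\mathcal V}^{-1}\Phi_v^T\mathcal P_{F^1}F^1(w)\\ \Phi_e\widehat M_{\mathcal E}^{-1}\Phi_e^T\mathcal P_{F^{tv}}F^{tv}(w)\\ \Phi_x\Phi_x^T v\end{pmatrix},\qquad w=(v,e,x).$$ Then there exists a constant $C>0$ such that for $n\ge 0$ (with $n\le \widetilde N_t$), $$|||(\delta_{v,n},\delta_{e,n},\delta_{x,n})|||\le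 e^{Ct_n}\Big(|||(\delta_{v,0},\delta_{e,0},\delta_{x,0})||| + C(\Delta t)^2\Big),$$ where $\Delta t=\max_{0\le j\le \widetilde N_t-1}\Delta t_j$ and $\delta_{v,n},\delta_{e,n},\delta_{x,n}$ are the differences at time $t_n$ between the lifted continuous-in-time reduced order approximation and the lifted RK2-average fully discrete reduced order approximation.
   Context: Spaces and norms. $\mathcal V$ (kinematic) and $\mathcal E$ (thermodynamic) are finite element spaces of dimensions $N_{\mathcal V}$ and $N_{\mathcal E}$; their elements are identified with coefficient vectors in $\mathbb{R}^{N_{\mathcal V}}$ and $\mathbb{R}^{N_{\mathcal E}}$. The mass matrices $M_{\mathcal V}\in\mathbb{R}^{N_{\mathcal V}\times N_{\mathcal V}}$ and $M_{\mathcal E}\in\mathbb{R}^{N_{\mathcal E}\times N_{\mathcal E}}$ are symmetric positive definite and constant in time. Put $\|v\|_{M_{\mathcal V}}^2 = v^T M_{\mathcal V} v$, $\|e\|_{M_{\mathcal E}}^2 = e^T M_{\mathcal E} e$, let $\|\cdot\|_2$ be the Euclidean norm, and on $\mathcal V\times\mathcal E\times\mathcal V$ define $$|||(v,e,x)|||^2 = \|v\|_{M_{\mathcal V}}^2 + \|e\|_{M_{\mathcal E}}^2 + \|x\|_2^2 .$$ Force functions. $\boldsymbol F=\boldsymbol F(v,e,x)\in\mathbb{R}^{N_{\mathcal V}\times N_{\mathcal E}}$ is the (nonlinear, matrix-valued) force matrix depending on the state $(v,e,x)$, and $F^1(v,e,x) = \boldsymbol F(v,e,x)\,\mathbf 1\in\mathbb{R}^{N_{\mathcal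 V}}$ (with $\mathbf 1\in\mathbb{R}^{N_{\mathcal E}}$ the vector of ones), $F^{tv}(v,e,x) = \boldsymbol F(v,e,x)^T v\in\mathbb{R}^{N_{\mathcal E}}$. The dependence on the problem parameter is fixed and suppressed. Reduced order model (ROM). $\Phi_v\in\mathbb{R}^{N_{\mathcal V}\times n_v}$, $\Phi_e\in\mathbb{R}^{N_{\mathcal E}\times n_e}$, $\Phi_x\in\mathbb{R}^{N_{\mathcal V}\times n_x}$ are basis matrices with orthonormal columns; $v_{os}\in\mathbb{R}^{N_{\mathcal V}}$, $e_{os}\in\mathbb{R}^{N_{\mathcal E}}$, $x_{os}\in\mathbb{R}^{N_{\mathcal V}}$ are prescribed offset vectors (constant in time). The reduced mass matrices are $\widehat M_{\mathcal V}=\Phi_v^T M_{\mathcal V}\Phi_v$, $\widehat M_{\mathcal E}=\Phi_e^T M_{\mathcal E}\Phi_e$. The oblique projection matrices are $$\mathcal P_{F^1}=\Phi_{F^1}(Z_{F^1}^T\Phi_{F^1})^{\dagger}Z_{F^1}^T\in\mathbb{R}^{N_{\mathcal V}\times N_{\mathcal V}},\qquad \mathcal P_{F^{tv}}=\Phi_{F^{tv}}(Z_{F^{tv}}^T\Phi_{F^{tv}})^{\dagger}Z_{F^{tv}}^T\in\mathbb{R}^{N_{\mathcal E}\times N_{\mathcal E}},$$ where $\Phi_{F^1}$, $\Phi_{F^{tv}}$ are the nonlinear-term basis matrices, $Z_{F^1}$, $Z_{F^{tv}}$ are sampling matrices (whose columns are selected columns of the identity matrix, at least as many as the columns of the corresponding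 basis matrix), $Z^T\Phi$ has full column rank in each case, and $A^\dagger=(A^TA)^{-1}A^T$. Continuous-in-time ROM on $[0,t_f]$ for $(\widehat v(t),\widehat e(t),\widehat x(t))$, with prescribed initial values: $$\widehat M_{\mathcal V}\frac{d\widehat v}{dt} = -\Phi_v^T\mathcal P_{F^1}F^1(\tilde v,\tilde e,\tilde x),\qquad \widehat M_{\mathcal E}\frac{d\widehat e}{dt} = \Phi_e^T\mathcal P_{F^{tv}}F^{tv}(\tilde v,\tilde e,\tilde x),\qquad \frac{d\widehat x}{dt}=\Phi_x^T\tilde v,$$ where $\tilde v(t) = v_{os}+\Phi_v\widehat v(t)$, $\tilde e(t)=e_{os}+\Phi_e\widehat e(t)$, $\tilde x(t)=x_{os}+\Phi_x\widehat x(t)$. RK2-average fully discrete ROM. Let $0=t_0<t_1<\dots<t_{\widetilde N_t}=t_f$ be the temporal grid of the fully discrete ROM (the step sizes, in general nonuniform, come from an adaptive time step control), $\Delta t_n=t_{n+1}-t_n$. Given initial values $(\widehat v_0,\widehat e_0,\widehat x_0)$, for $0\le n\le\widetilde N_t-1$: First stage: $$\widehat v_{n+\frac12}=\widehat v_n-\tfrac{\Delta t_n}{2}\widehat M_{\mathcal V}^{-1}\Phi_v^T\mathcal P_{F^1}\boldsymbol F(\tilde w_n)\mathbf 1,\quad \widehat e_{n+\frac12}=\widehat e_n+\tfrac{\Delta t_n}{2}\widehat M_{\mathcal E}^{-1}\Phi_e^T\mathcal P_{F^{tv}}\boldsymbol F(\tilde w_n)^T\tilde v_{n+\frac12},\quad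 \widehat x_{n+\frac12}=\widehat x_n+\tfrac{\Delta t_n}{2}\Phi_x^T\tilde v_{n+\frac12};$$ Second stage: $$\widehat v_{n+1}=\widehat v_n-\Delta t_n\widehat M_{\mathcal V}^{-1}\Phi_v^T\mathcal P_{F^1}\boldsymbol F(\tilde w_{n+\frac12})\mathbf 1,\quad \widehat e_{n+1}=\widehat e_n+\Delta t_n\widehat M_{\mathcal E}^{-1}\Phi_e^T\mathcal P_{F^{tv}}\boldsymbol F(\tilde w_{n+\frac12})^T\bar{\tilde v}_{n+\frac12},\quad \widehat x_{n+1}=\widehat x_n+\Delta t_n\Phi_x^T\bar{\tilde v}_{n+\frac12},$$ where, for each index $m\in\{n,n+\frac12,n+1\}$, $\tilde w_m=(\tilde v_m,\tilde e_m,\tilde x_m)$ with $\tilde v_m=v_{os}+\Phi_v\widehat v_m$, $\tilde e_m=e_{os}+\Phi_e\widehat e_m$, $\tilde x_m=x_{os}+\Phi_x\widehat x_m$, and $\bar{\tilde v}_{n+\frac12}=(\tilde v_n+\tilde v_{n+1})/2$. Errors: $\delta_{v,n}=\tilde v(t_n)-\tilde v_n=\Phi_v(\widehat v(t_n)-\widehat v_n)$, $\delta_{e,n}=\tilde e(t_n)-\tilde e_n=\Phi_e(\widehat e(t_n)-\widehat e_n)$, $\delta_{x,n}=\tilde x(t_n)-\tilde x_n=\Phi_x(\widehat x(t_n)-\widehat x_n)$. *)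

(* Defs.v *)
From HB Require Import structures.
From mathcomp Require Export all_boot all_order all_algebra.
From mathcomp Require Export all_classical all_reals all_analysis.
Export Order.TTheory GRing.Theory Num.Theory.
Export numFieldNormedType.Exports.

Set Implicit Arguments.
Unset Strict Implicit.
Unset Printing Implicit Defensive.

Local Open Scope classical_set_scope.
Local Open Scope ring_scope.

(* (v, e, x), identified with coefficient vectors *)
Notation state R NV NE := ('cV[R]_NV * 'cV[R]_NE * 'cV[R]_NV)%type.

Definition spd (R : realType) (n : nat) (M : 'M[R]_n) : Prop :=
  M^T = M /\ forall u : 'cV[R]_n, u != 0 -> 0 < (u^T *m M *m u) 0 0.

(* The library norm on matrices is the sup norm, hence these two norms. *)
Definition mass_norm (R : realType) (n : nat) (M : 'M[R]_n) (u : 'cV[R]_n) : R :=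
  Num.sqrt ((u^T *m M *m u) 0 0).

Definition euclid_norm (R : realType) (n : nat) (u : 'cV[R]_n) : R :=
  Num.sqrt (\sum_(i < n) u i 0 ^+ 2).

Definition left_pinv (R : realType) (m n : nat) (A : 'M[R]_(m, n)) :
  'M[R]_(n, m) := invmx (A^T *m A) *m A^T.

Definition sampling_mx (R : realType) (m n : nat) (s : 'I_n -> 'I_m) :
  'M[R]_(m, n) := colsub s 1%:M.

Definition oblique_proj (R : realType) (m k z : nat)
    (Phi : 'M[R]_(m, k)) (Z : 'M[R]_(m, z)) : 'M[R]_m :=
  Phi *m left_pinv (Z^T *m Phi) *m Z^T.

(* Class C^k on a finite-dimensional space: differentiability everywhere and
   all directional derivatives w |-> Df(w)[h] of class C^(k-1).  In finite
   dimension this is equivalent to the continuity of the iterated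
   differentials in operator norm. *)
Fixpoint class_C (R : realType) (V W : normedModType R) (k : nat)
    (f : V -> W) : Prop :=
  if k is k'.+1 then
    (forall w, differentiable f w) /\
    (forall h, class_C k' (fun w => 'd f w h))
  else continuous f.

Record rom (R : realType) (NV NE : nat) := Rom {
  MV : 'M[R]_NV;
  ME : 'M[R]_NE;
  MV_spd : spd MV;
  ME_spd : spd ME;
  nv : nat;
  ne : nat;
  nx : nat;
  Phiv : 'M[R]_(NV, nv);
  Phie : 'M[R]_(NE, ne);
  Phix : 'M[R]_(NV, nx);
  Phiv_orth : Phiv^T *m Phiv = 1%:M;
  Phie_orth : Phie^T *m Phie = 1%:M;
  Phix_orth : Phix^T *m Phix = 1%:M;
  vos : 'cV[R]_NV;
  eos : 'cV[R]_NE;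
  xos : 'cV[R]_NV;
  nF1 : nat;
  nFtv : nat;
  zF1 : nat;
  zFtv : nat;
  PhiF1 : 'M[R]_(NV, nF1);
  PhiFtv : 'M[R]_(NE, nFtv);
  sF1 : 'I_zF1 -> 'I_NV;
  sFtv : 'I_zFtv -> 'I_NE;
  zF1_ge : (nF1 <= zF1)%N;
  zFtv_ge : (nFtv <= zFtv)%N;
  F1_rank : \rank ((sampling_mx R sF1)^T *m PhiF1) = nF1;
  Ftv_rank : \rank ((sampling_mx R sFtv)^T *m PhiFtv) = nFtv
}.

Notation rstate R S := ('cV[R]_(nv S) * 'cV[R]_(ne S) * 'cV[R]_(nx S))%type.

Definition triple_norm (R : realType) (NV NE : nat) (S : rom R NV NE)
    (w : state R NV NE) : R :=
  Num.sqrt (mass_norm (MV S) w.1.1 ^+ 2 + mass_norm (ME S) w.1.2 ^+ 2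
            + euclid_norm w.2 ^+ 2).

Definition F1 (R : realType) (NV NE : nat)
    (F : state R NV NE -> 'M[R]_(NV, NE)) (w : state R NV NE) : 'cV[R]_NV :=
  F w *m const_mx 1.

Definition Ftv (R : realType) (NV NE : nat)
    (F : state R NV NE -> 'M[R]_(NV, NE)) (w : state R NV NE) : 'cV[R]_NE :=
  (F w)^T *m w.1.1.

Definition rMV (R : realType) (NV NE : nat) (S : rom R NV NE) : 'M[R]_(nv S) :=
  (Phiv S)^T *m MV S *m Phiv S.

Definition rME (R : realType) (NV NE : nat) (S : rom R NV NE) : 'M[R]_(ne S) :=
  (Phie S)^T *m ME S *m Phie S.

Definition PF1 (R : realType) (NV NE : nat) (S : rom R NV NE) : 'M[R]_NV :=
  oblique_proj (PhiF1 S) (sampling_mx R (@sF1 _ _ _ S)).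

Definition PFtv (R : realType) (NV NE : nat) (S : rom R NV NE) : 'M[R]_NE :=
  oblique_proj (PhiFtv S) (sampling_mx R (@sFtv _ _ _ S)).

Definition lift_v (R : realType) (NV NE : nat) (S : rom R NV NE)
    (v : 'cV[R]_(nv S)) : 'cV[R]_NV := vos S + Phiv S *m v.

Definition lift (R : realType) (NV NE : nat) (S : rom R NV NE)
    (y : rstate R S) : state R NV NE :=
  (lift_v y.1.1, eos S + Phie S *m y.1.2, xos S + Phix S *m y.2).

Definition lifted_Euler (R : realType) (NV NE : nat) (S : rom R NV NE)
    (F : state R NV NE -> 'M[R]_(NV, NE)) (w : state R NV NE) : state R NV NE :=
  (- (Phiv S *m invmx (rMV S) *m (Phiv S)^T *m PF1 S *m F1 F w),
   Phie S *m invmx (rME S) *m (Phie S)^T *m PFtv S *m Ftv F w,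
   Phix S *m (Phix S)^T *m w.1.1).

(* Classical solution on [0, tf]: continuous up to the end points, with the
   differential equations holding in the interior. *)
Definition rom_solution (R : realType) (NV NE : nat) (S : rom R NV NE)
    (F : state R NV NE -> 'M[R]_(NV, NE)) (tf : R)
    (v : R -> 'cV[R]_(nv S)) (e : R -> 'cV[R]_(ne S))
    (x : R -> 'cV[R]_(nx S)) : Prop :=
  [/\ {within `[0, tf], continuous v},
      {within `[0, tf], continuous e},
      {within `[0, tf], continuous x} &
      forall t : R, 0 < t < tf ->
        let w := lift (v t, e t, x t) in
        [/\ derivable v t 1, derivable e t 1 & derivable x t 1] /\
        [/\ rMV S *m derive1 v t = - ((Phiv S)^T *m PF1 S *m F1 F w),
            rME S *m derive1 e t = (Phie S)^T *m PFtv S *m Ftv F w &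
            derive1 x t = (Phix S)^T *m w.1.1] ].

(* One step of size dt.  Both stages of the energy update use F^T times a
   velocity that is not the velocity component of the argument of F, so they
   are not values of Ftv. *)
Definition rk2_step (R : realType) (NV NE : nat) (S : rom R NV NE)
    (F : state R NV NE -> 'M[R]_(NV, NE)) (dt : R) (y : rstate R S) :
    rstate R S :=
  let: (v, e, x) := y in
  let w := lift y in
  let vh := v - (dt / 2) *:
    (invmx (rMV S) *m (Phiv S)^T *m PF1 S *m (F w *m const_mx 1)) in
  let eh := e + (dt / 2) *:
    (invmx (rME S) *m (Phie S)^T *m PFtv S *m ((F w)^T *m lift_v vh)) in
  let xh := x + (dt / 2) *: ((Phix S)^T *m lift_v vh) in
  let wh := lift (vh, eh, xh) in
  let v1 := v - dt *:
    (invmx (rMV S) *m (Phiv S)^T *m PF1 S *m (F wh *m const_mx 1)) in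
  let vbar := 2^-1 *: (lift_v v + lift_v v1) in
  let e1 := e + dt *:
    (invmx (rME S) *m (Phie S)^T *m PFtv S *m ((F wh)^T *m vbar)) in
  let x1 := x + dt *: ((Phix S)^T *m vbar) in
  (v1, e1, x1).

Fixpoint rk2_run (R : realType) (NV NE : nat) (S : rom R NV NE)
    (F : state R NV NE -> 'M[R]_(NV, NE)) (t : nat -> R) (y0 : rstate R S)
    (n : nat) : rstate R S :=
  if n is m.+1 then rk2_step F (t m.+1 - t m) (rk2_run F t y0 m) else y0.

(* Only the values t 0, ..., t N are meaningful. *)
Definition temporal_grid (R : realType) (tf : R) (N : nat) (t : nat -> R) :
  Prop := [/\ t 0%N = 0, t N = tf & forall j, (j < N)%N -> t j < t j.+1].

Definition max_step (R : realType) (N : nat) (t : nat -> R) : R :=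
  \big[Num.max/0]_(j < N) (t j.+1 - t j).

Definition rom_error (R : realType) (NV NE : nat) (S : rom R NV NE)
    (F : state R NV NE -> 'M[R]_(NV, NE)) (v : R -> 'cV[R]_(nv S))
    (e : R -> 'cV[R]_(ne S)) (x : R -> 'cV[R]_(nx S)) (t : nat -> R)
    (y0 : rstate R S) (n : nat) : state R NV NE :=
  lift (v (t n), e (t n), x (t n)) - lift (rk2_run F t y0 n).

(* Main.v *)
From HB Require Import structures.
From mathcomp Require Import ring lra.
Require Import Defs.

(* In reduced coordinates the ROM is an autonomous equation y' = f y and the
   RK2-average scheme reads y_(n+1) = y_n + h * slope (y_n, h), where slope is
   jointly Lipschitz in (y, h) on balls and slope (y, 0) = f y.

   Local truncation error: as f has second differences f (a + d) + f (a - d)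
   - 2 f a = O(|d|^2) on balls, the mean value inequality applied to
   s |-> y (m + s) - y (m - s) - 2 s f (y m) gives the midpoint rule
   y (t + h) - y t = h f (y (t + h/2)) + O(h^3), while slope (y t, h) differs
   from f (y (t + h/2)) by O(h^2).

   Stability: slope is only locally Lipschitz, because the energy update pairs
   the force matrix with another velocity.  The global Lipschitz bounds on F1
   and Ftv make f globally Lipschitz, so slope = f + O(h) yields a first-order
   error estimate whose exponential rate does not depend on the size of the
   ball; for small steps it confines the scheme to a tube around the exact
   solution.  In the tube slope is Lipschitz and Gronwall's lemma gives the
   second-order estimate.  For a grid with larger steps, boundedness of the
   finitely many iterates suffices. *)

Set Implicit Arguments.
Unset Strict Implicit.
Unset Printing Implicit Defensive.

Local Open Scope classical_set_scope.
Local Open Scope ring_scope.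

(** * Finite-dimensional normed modules in coordinates *)

Section Coordinates.
Context {R : realType}.

(* A finite basis b with dual functionals c for which the norm of V is the sup
   of the coordinates, as for matrices and their products. *)
Definition coordinates (V : normedModType R) (I : finType) (b : I -> V)
    (c : I -> {linear V -> R^o}) : Prop :=
  (forall w, w = \sum_i c i w *: b i) /\
  (forall w (K : R), 0 <= K -> (`|w| <= K <-> forall i, `|c i w| <= K)).

Definition finite_coordinates (V : normedModType R) : Prop :=
  exists (I : finType) (b : I -> V) (c : I -> {linear V -> R^o}),
    coordinates b c.

Lemma mx_norm_leP m n (A : 'M[R]_(m, n)) (K : R) :
  0 <= K -> (`|A| <= K <-> forall i j, `|A i j| <= K).
Proof.
move=> K0; rewrite {1}/Num.norm/= mx_normrE; split.
  by move=> /bigmax_leP[_ H] i j; exact: (H (i, j)).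
by move=> H; apply/bigmax_leP; split => // -[i j] _; exact: H.
Qed.

Lemma mx_entry_norm m n (A : 'M[R]_(m, n)) i j : `|A i j| <= `|A|.
Proof. by move: i j; apply/mx_norm_leP. Qed.

Lemma coordinates_norm (V : normedModType R) (I : finType) (b : I -> V) c :
  coordinates b c -> forall i w, `|c i w| <= `|w|.
Proof. by move=> [_ H] i w; move: i; apply/H. Qed.

Definition entry m n (ij : 'I_m * 'I_n) (A : 'M[R]_(m, n)) : R^o :=
  A ij.1 ij.2.

Lemma entry_is_linear m n ij : linear (@entry m n ij).
Proof. by move=> a A B; rewrite /entry !mxE. Qed.

HB.instance Definition _ m n ij :=
  GRing.isLinear.Build R 'M[R]_(m, n) R^o _ (@entry m n ij)
    (@entry_is_linear m n ij).

Lemma mx_coordinates m n : finite_coordinates 'M[R]_(m, n).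
Proof.
exists ('I_m * 'I_n)%type, (fun ij => delta_mx ij.1 ij.2),
  (fun ij => entry ij); split=> [A|A K K0].
  rewrite {1}[A]matrix_sum_delta.
  by rewrite pair_bigA.
rewrite mx_norm_leP//; split => [H [i j]|H i j]; first exact: H.
exact: (H (i, j)).
Qed.

Section Pair.
Variables (V W : normedModType R) (I J : finType).
Variables (c : I -> {linear V -> R^o}) (d : J -> {linear W -> R^o}).

Definition pair_coord (k : I + J) (w : V * W) : R^o :=
  match k with inl i => c i w.1 | inr j => d j w.2 end.

Lemma pair_coord_is_linear k : linear (pair_coord k).
Proof. by case: k => k a u v /=; rewrite linearP. Qed.

HB.instance Definition _ k :=
  GRing.isLinear.Build R (V * W)%type R^o _ (pair_coord k)
    (pair_coord_is_linear k).
End Pair.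

Lemma sum_pair (V W : normedModType R) (I : finType) (f : I -> V) (g : I -> W) :
  \sum_i (f i, g i) = (\sum_i f i, \sum_i g i) :> V * W.
Proof. by elim/big_rec3 : _ => // i x y z _ ->. Qed.

Lemma prod_coordinates (V W : normedModType R) :
  finite_coordinates V -> finite_coordinates W ->
  finite_coordinates (V * W)%type.
Proof.
move=> [I [b [c [bE cN]]]] [J [b' [d [b'E dN]]]].
exists (I + J)%type,
  (fun k => match k with inl i => (b i, 0) | inr j => (0, b' j) end),
  (fun k => pair_coord c d k); split=> [[v w]|[v w] K K0].
  have scl i : c i v *: (b i, 0) = (c i v *: b i, 0) :> V * W.
    by congr pair; rewrite scaler0.
  have scr j : d j w *: (0, b' j) = (0, d j w *: b' j) :> V * W.
    by congr pair; rewrite scaler0.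
  rewrite big_sumType /= (eq_bigr _ (fun i _ => scl i)).
  rewrite [X in _ + X](eq_bigr _ (fun j _ => scr j)).
  rewrite !sum_pair -bE -b'E !big1//.
  by congr pair; rewrite ?addr0 ?add0r.
rewrite prod_normE ge_max; split.
  move=> /andP[/(cN _ _ K0) H /(dN _ _ K0) H'].
  by case.
move=> H; apply/andP; split.
  by apply/(cN _ _ K0) => i; exact: (H (inl i)).
by apply/(dN _ _ K0) => j; exact: (H (inr j)).
Qed.

Lemma bounded_functional_continuous (V : normedModType R)
    (l : {linear V -> R^o}) : (forall w, `|l w| <= `|w|) -> continuous l.
Proof.
move=> lN; apply: bounded_linear_continuous; apply/linear_boundedP.
near=> r => w; apply: le_trans (lN w) _; rewrite ler_peMl//.
Unshelve. all: by end_near. Qed.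

Lemma is_derive_functional (V : normedModType R) (l : {linear V -> R^o})
    (phi : R -> V) (t : R) (d : V) :
  continuous l -> is_derive t 1 phi d -> is_derive t 1 (l \o phi : R -> R^o) (l d).
Proof.
move=> lc [phid phiE].
suff H : (fun h => h^-1 *: (((l \o phi) \o shift t) (h *: 1) - (l \o phi) t))
   @ 0^' --> l d.
  split; first by apply/cvg_ex; exists (l d).
  exact: cvg_lim H.
have {}H : (fun h => h^-1 *: ((phi \o shift t) (h *: 1) - phi t)) @ 0^' --> d.
  by rewrite -phiE; exact: phid.
have := @cvg_comp _ _ _ _ l _ _ _ H (lc d).
by apply: cvg_trans; apply: near_eq_cvg; near=> h; rewrite /= linearZ linearB.
Unshelve. all: by end_near.
Qed.

(** The scalar mean value theorem is applied in each coordinate. The intermediate point depends on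
    the coordinate, but since the norm is the sup of the coordinates no constant is lost. *)
Lemma mean_value_inequality (V : normedModType R) (phi dphi : R -> V)
    (a b K : R) :
  finite_coordinates V -> a <= b -> 0 <= K ->
  {within `[a, b], continuous phi} ->
  (forall t, a < t < b -> is_derive t 1 phi (dphi t)) ->
  (forall t, a < t < b -> `|dphi t| <= K) ->
  `|phi b - phi a| <= K * (b - a).
Proof.
move=> [I [bb [c bc]]]; rewrite le_eqVlt => /predU1P[<-|ab] K0 cphi dphiE dphiK.
  by rewrite !subrr normr0 mulr0.
have cN := coordinates_norm bc.
have cc i := bounded_functional_continuous (cN i).
case: bc => _ /(_ (phi b - phi a) (K * (b - a))) [|_]; first last.
  apply=> i; rewrite linearB.
  have [t tab ->] : exists2 t, t \in `]a, b[ &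
      c i (phi b) - c i (phi a) = c i (dphi t) * (b - a).
    apply: (@MVT R (c i \o phi) (fun t => c i (dphi t)) a b ab) => [t|t].
      rewrite in_itv/= => tab; apply: is_derive_functional => //.
      exact: dphiE.
    apply: (@continuous_comp (subspace `[a, b]) V R^o phi (c i)).
      exact: cphi.
    exact: cc.
  have ba0 : 0 <= b - a by rewrite subr_ge0 ltW.
  rewrite in_itv/= in tab.
  rewrite normrM (ger0_norm ba0) ler_wpM2r//; apply: le_trans (cN _ _) _.
  exact: dphiK.
by rewrite mulr_ge0// subr_ge0 ltW.
Qed.

Lemma linear_combination_continuous (U V : normedModType R) (I : finType)
    (b : I -> V) (l : I -> {linear U -> R^o}) :
  (forall i, continuous (l i)) -> continuous (fun u => \sum_i l i u *: b i).
Proof.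
move=> lc; apply: (@continuous_big V I +%R 0 xpredT (@add_continuous V) U
  (index_enum I) (fun i u => l i u *: b i)).
by move=> i _ u; apply: cvgZr_tmp; exact: lc.
Qed.

(** A ball lies in the image of a compact box of row vectors under the continuous map [T] that sends
    coordinates to their vector, so compactness of boxes suffices. *)
Lemma bounded_on_balls (V : normedModType R) (g : V -> R^o) (r : R) :
  finite_coordinates V -> continuous g ->
  exists2 B, 0 <= B & forall w, `|w| <= r -> `|g w| <= B.
Proof.
move=> [I [b [c bc]]] gc; have cN := coordinates_norm bc.
pose U : normedModType R := 'rV[R]_#|I|.
pose l i : {linear U -> R^o} := entry (0, enum_rank i).
pose T (u : U) : V := \sum_i l i u *: b i.
have Tc : continuous T.
  apply: linear_combination_continuous => i.
  by apply: bounded_functional_continuous => w; exact: mx_entry_norm.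
pose A := [set u : 'rV[R]_#|I| | forall i, `[- r, r]%classic (u 0 i)].
have Ac : compact A.
  apply: (@rV_compact R _ (fun=> `[- r, r]%classic)) => i.
  exact: segment_compact.
have : compact ((g \o T) @` A).
  apply: continuous_compact => //; apply: continuous_subspaceT => u.
  by apply: continuous_comp; [exact: Tc|exact: gc].
move=> /compact_bounded /ex_strict_bound_gt0[B B0 HB].
exists `|B| => // w wr.
have -> : w = T (\row_k c (enum_val k) w).
  rewrite {1}(bc.1 w) /T; apply: eq_bigr => i _.
  by rewrite /l /= /entry mxE enum_rankK.
rewrite (le_trans _ (ler_norm B))// ltW// HB//=.
exists (\row_k c (enum_val k) w) => //.
by move=> k /=; rewrite mxE in_itv/= -ler_norml (le_trans (cN _ _)).
Qed.

(** Expansion in a basis gives the upper bound and makes [N] Lipschitz, hence continuous. The lower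
    bound holds on the unit sphere by compactness and extends by homogeneity. *)
Lemma seminorm_equivalence (V : normedModType R) (N : V -> R) :
  finite_coordinates V ->
  (forall a b, N (a + b) <= N a + N b) ->
  (forall k a, N (k *: a) = `|k| * N a) ->
  (forall a, N a = 0 -> a = 0) ->
  exists C : R, [/\ 0 < C, forall a, N a <= C * `|a| & forall a, `|a| <= C * N a].
Proof.
move=> Vfin ND NZ N0.
have N00 : N 0 = 0 by rewrite -(scale0r 0) NZ normr0 mul0r.
have NN a : N (- a) = N a by rewrite -scaleN1r NZ normrN1 mul1r.
have Nge0 a : 0 <= N a.
  by have := ND a (- a); rewrite subrr N00 NN -mulr2n pmulrn_lge0.
have [C1 C10 NC1] : exists2 C, 0 <= C & forall a, N a <= C * `|a|.
  have [I [b [c bc]]] := Vfin; exists (\sum_i N (b i)); first exact: sumr_ge0.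
  move=> a; rewrite {1}(bc.1 a) mulr_suml.
  elim/big_rec2 : _ => [|i x y _ xy]; first by rewrite N00.
  apply: le_trans (ND _ _) _; apply: lerD => //.
  by rewrite NZ mulrC ler_wpM2l//; exact: coordinates_norm bc _ _.
have Nlip a b : `|N a - N b| <= C1 * `|a - b|.
  apply: le_trans (NC1 (a - b)); rewrite ler_norml lerBlDr; apply/andP; split.
    rewrite lerNl opprB lerBlDr -(NN (a - b)) opprB.
    by apply: le_trans (ND _ _); rewrite subrK.
  by apply: le_trans (ND _ _); rewrite subrK.
have Nc : continuous (N : V -> R^o).
  move=> a; apply/(@cvgrPdist_le _ R^o) => e e0; near=> b.
  apply: le_trans (Nlip _ _) _.
  have {}C1' : C1 <= C1 + 1 by rewrite lerDl.
  apply: le_trans (ler_wpM2r _ C1') _ => //.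
  rewrite mulrC -ler_pdivlMr ?ltr_wpDl//.
  near: b; apply: (@cvgr_dist_le _ _ _ _ _ id); first exact: cvg_id.
  by rewrite divr_gt0 ?ltr_wpDl.
have [C2 C20 HC2] : exists2 C, 0 <= C & forall a, `|a| = 1 -> 1 <= C * N a.
  have gE a : N a + `|1 - `|a| | != 0.
    rewrite paddr_eq0//; apply/negP => /andP[/eqP/N0 ->].
    by rewrite normr0 subr0 normr1 oner_eq0.
  (* The extra term vanishes on the unit sphere and keeps the inverse
     continuous at 0. *)
  pose g a : R^o := (N a + `|1 - `|a| |)^-1.
  have gc : continuous g.
    move=> a; apply: cvgV => //; apply: cvgD; first exact: Nc.
    apply: (@cvg_norm _ R^o); apply: cvgB; first exact: cvg_cst.
    exact: cvg_norm.
  have [B B0 gB] := bounded_on_balls 1 Vfin gc.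
  exists B => // a a1; have := gB a; rewrite a1 lexx => /(_ erefl).
  rewrite /g a1 subrr normr0 addr0 ger0_norm ?invr_ge0//.
  have Na : 0 < N a.
    have := gE a; rewrite a1 subrr normr0 addr0 => Na0.
    by rewrite lt_neqAle eq_sym Na0 Nge0.
  have NV : (N a)^-1 * N a = 1 :> R by rewrite mulVf ?gt_eqF.
  by move=> NB; rewrite -NV; apply: ler_wpM2r.
(* One constant for both inequalities; the summand 1 makes it positive. *)
exists (1 + C1 + C2); split => [|a|a].
- by rewrite ltr_wpDr// ltr_wpDr.
- apply: le_trans (NC1 a) _; rewrite ler_wpM2r// (addrC 1) -addrA lerDl.
  by rewrite addr_ge0.
- have [->|a0] := eqVneq a 0; first by rewrite normr0 mulr_ge0// !addr_ge0.
  have na0 : 0 < `|a| by rewrite normr_gt0.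
  have := HC2 (`|a|^-1 *: a).
  rewrite normrZ normfV normr_id mulVf ?gt_eqF// => /(_ erefl).
  rewrite NZ normfV normr_id mulrCA ler_pdivlMl// mulr1 => /le_trans; apply.
  by rewrite ler_wpM2r// lerDr addr_ge0.
Unshelve. all: by end_near. Qed.

End Coordinates.

(** * Regularity on balls *)

Section BallRegularity.
Context {R : realType}.
Implicit Types V W X : normedModType R.

(** Letting the constant depend on the radius makes the class stable under bilinear products, which
    destroy global Lipschitz bounds. *)
Definition lipschitz_on_balls V W (f : V -> W) : Prop :=
  forall r : R, exists2 L : R, 0 <= L &
    forall a b, `|a| <= r -> `|b| <= r -> `|f a - f b| <= L * `|a - b|.

(** A substitute for a locally bounded second derivative that passes through affine substitutions
    and bilinear products by algebra alone. *)
Definition second_difference_on_balls V W (f : V -> W) : Prop :=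
  forall r : R, exists2 C : R, 0 <= C &
    forall a d, `|a| <= r -> `|d| <= r ->
      `|f (a + d) + f (a - d) - 2 *: f a| <= C * `|d| ^+ 2.

Lemma lipschitz_on_balls_bounded V W (f : V -> W) (r : R) :
  lipschitz_on_balls f -> exists2 B, 0 <= B & forall a, `|a| <= r -> `|f a| <= B.
Proof.
(* The radius [|r|] puts 0 in the ball even if [r] is negative. *)
move=> /(_ `|r|)[L L0 fL]; exists (L * `|r| + `|f 0|) => [|a ar].
  by rewrite addr_ge0// mulr_ge0.
have ar' := le_trans ar (ler_norm r).
rewrite -[f a](subrK (f 0)) (le_trans (ler_normD _ _))// lerD2r.
apply: le_trans (fL _ _ ar' _) _; first by rewrite normr0.
by rewrite subr0 ler_wpM2l.
Qed.

Lemma lipschitz_on_balls_global V W (f : V -> W) (L : R) : 0 <= L ->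
  (forall a b, `|f a - f b| <= L * `|a - b|) -> lipschitz_on_balls f.
Proof. by move=> L0 fL r; exists L. Qed.

Lemma lipschitz_on_balls_cst V W (w : W) : lipschitz_on_balls (fun _ : V => w).
Proof.
by apply: (@lipschitz_on_balls_global _ _ _ 0) => // a b; rewrite subrr normr0 mul0r.
Qed.

Lemma lipschitz_on_balls_id V : lipschitz_on_balls (@id V).
Proof. by apply: (@lipschitz_on_balls_global _ _ _ 1) => // a b; rewrite mul1r. Qed.

Lemma lipschitz_on_balls_fst V W : lipschitz_on_balls (@fst V W).
Proof.
apply: (@lipschitz_on_balls_global _ _ _ 1) => // a b.
by rewrite mul1r prod_normE le_max lexx.
Qed.

Lemma lipschitz_on_balls_snd V W : lipschitz_on_balls (@snd V W).
Proof.
apply: (@lipschitz_on_balls_global _ _ _ 1) => // a b.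
by rewrite mul1r prod_normE le_max lexx orbT.
Qed.

Lemma lipschitz_on_balls_comp V W X (g : W -> X) (f : V -> W) :
  lipschitz_on_balls g -> lipschitz_on_balls f -> lipschitz_on_balls (g \o f).
Proof.
move=> gl fl r; have [B B0 fB] := lipschitz_on_balls_bounded r fl.
have [L L0 fL] := fl r; have [K K0 gK] := gl B.
exists (K * L) => [|a b ar br]; first exact: mulr_ge0.
rewrite -mulrA (le_trans (gK _ _ (fB _ ar) (fB _ br)))//.
by rewrite ler_wpM2l// fL.
Qed.

Lemma lipschitz_on_balls_pair V W X (f : V -> W) (g : V -> X) :
  lipschitz_on_balls f -> lipschitz_on_balls g ->
  lipschitz_on_balls (fun a => (f a, g a)).
Proof.
move=> fl gl r; have [L L0 fL] := fl r; have [K K0 gK] := gl r.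
exists (L + K) => [|a b ar br]; first exact: addr_ge0.
rewrite prod_normE ge_max /= mulrDl.
rewrite (le_trans (fL _ _ ar br)) ?lerDl ?mulr_ge0//=.
by rewrite (le_trans (gK _ _ ar br)) ?lerDr ?mulr_ge0.
Qed.

Lemma lipschitz_on_ballsD V W (f g : V -> W) :
  lipschitz_on_balls f -> lipschitz_on_balls g ->
  lipschitz_on_balls (fun a => f a + g a).
Proof.
move=> fl gl r; have [L L0 fL] := fl r; have [K K0 gK] := gl r.
exists (L + K) => [|a b ar br]; first exact: addr_ge0.
rewrite opprD addrACA mulrDl (le_trans (ler_normD _ _))// lerD//.
  exact: fL.
exact: gK.
Qed.

Lemma lipschitz_on_ballsN V W (f : V -> W) :
  lipschitz_on_balls f -> lipschitz_on_balls (fun a => - f a).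
Proof.
move=> fl r; have [L L0 fL] := fl r; exists L => // a b ar br.
by rewrite -opprD normrN; exact: fL.
Qed.

(** A common interface for scalar multiples and matrix products; additivity in each argument is what
    the difference identities below rest on. *)
Definition bilinear_bounded V W X (p : V -> W -> X) (C : R) : Prop :=
  [/\ 0 <= C, forall a b c, p (a + b) c = p a c + p b c,
      forall a b c, p a (b + c) = p a b + p a c &
      forall a b, `|p a b| <= C * (`|a| * `|b|)].

Lemma lipschitz_on_balls_bilinear V W X (Z : normedModType R) (p : W -> X -> Z) C
    (f : V -> W) (g : V -> X) : bilinear_bounded p C ->
  lipschitz_on_balls f -> lipschitz_on_balls g ->
  lipschitz_on_balls (fun a => p (f a) (g a)).
Proof.
move=> [C0 pDl pDr pN] fl gl r.
have [B B0 fB] := lipschitz_on_balls_bounded r fl.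
have [D D0 gD] := lipschitz_on_balls_bounded r gl.
have [L L0 fL] := fl r; have [K K0 gK] := gl r.
exists (C * (L * D + B * K)) => [|a b ar br].
  by rewrite mulr_ge0// addr_ge0// mulr_ge0.
have -> : p (f a) (g a) - p (f b) (g b) =
    p (f a - f b) (g a) + p (f b) (g a - g b).
  apply: (addIr (p (f b) (g b))).
  by rewrite subrK -addrA -pDr subrK -pDl subrK.
rewrite mulrDr mulrDl (le_trans (ler_normD _ _))// lerD//.
  apply: le_trans (pN _ _) _; rewrite -!mulrA ler_wpM2l// (mulrC D) mulrA.
  by rewrite ler_pM// ?fL ?gD.
apply: le_trans (pN _ _) _; rewrite -!mulrA ler_wpM2l//.
by rewrite ler_pM// ?fB ?gK.
Qed.

Lemma second_difference_on_balls_global V W (f : V -> W) (C : R) : 0 <= C ->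
  (forall a d, `|f (a + d) + f (a - d) - 2 *: f a| <= C * `|d| ^+ 2) ->
  second_difference_on_balls f.
Proof. by move=> C0 fC r; exists C. Qed.

Lemma second_difference_on_balls_linear V W X (l : {linear W -> X}) (L : R)
    (f : V -> W) :
  0 <= L -> (forall w, `|l w| <= L * `|w|) ->
  second_difference_on_balls f -> second_difference_on_balls (l \o f).
Proof.
move=> L0 lL fs r; have [C C0 fC] := fs r.
exists (L * C) => [|a d ar dr]; first exact: mulr_ge0.
rewrite /= -linearZ -linearD -linearB -mulrA (le_trans (lL _))//.
by rewrite ler_wpM2l// fC.
Qed.

Lemma second_difference_on_balls_pair V W X (f : V -> W) (g : V -> X) :
  second_difference_on_balls f -> second_difference_on_balls g ->
  second_difference_on_balls (fun a => (f a, g a)).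
Proof.
move=> fs gs r; have [L L0 fL] := fs r; have [K K0 gK] := gs r.
exists (L + K) => [|a d ar dr]; first exact: addr_ge0.
rewrite prod_normE ge_max /= mulrDl.
rewrite (le_trans (fL _ _ ar dr)) ?lerDl ?mulr_ge0 ?sqr_ge0//=.
by rewrite (le_trans (gK _ _ ar dr)) ?lerDr ?mulr_ge0 ?sqr_ge0.
Qed.

(** Both products are expanded about [(f a, g a)]. The terms linear in the increments combine into
    second differences of [f] and [g]; each remaining term pairs two first differences and is
    quadratic in [d] by the Lipschitz bounds. *)
Lemma second_difference_on_balls_bilinear V W X (Z : normedModType R) (p : W -> X -> Z) C
    (f : V -> W) (g : V -> X) : bilinear_bounded p C ->
  lipschitz_on_balls f -> lipschitz_on_balls g ->
  second_difference_on_balls f -> second_difference_on_balls g ->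
  second_difference_on_balls (fun a => p (f a) (g a)).
Proof.
move=> [C0 pDl pDr pN] fl gl fs gs r.
(* The ball of radius [r + r] contains [a + d] and [a - d]. *)
have [B B0 fB] := lipschitz_on_balls_bounded (r + r) fl.
have [D D0 gD] := lipschitz_on_balls_bounded (r + r) gl.
have [L L0 fL] := fl (r + r); have [K K0 gK] := gl (r + r).
have [S S0 fS] := fs r; have [T T0 gT] := gs r.
exists (C * (S * D) + C * (B * T) + (C * (L * K) + C * (L * K))) => [|a d ar dr].
  by rewrite !addr_ge0// !mulr_ge0.
have r0 : 0 <= r by exact: le_trans ar.
have ar2 : `|a| <= r + r by rewrite (le_trans ar)// lerDl.
have adr : `|a + d| <= r + r by rewrite (le_trans (ler_normD _ _))// lerD.
have adr' : `|a - d| <= r + r by rewrite (le_trans (ler_normB _ _))// lerD.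
have sdE (Y : normedModType R) (x y z : Y) : x + y - 2 *: z = (x - z) + (y - z).
  by rewrite addrACA -opprD -mulr2n scaler_nat.
have pE x y u v : p x y - p u v =
    p (x - u) v + p u (y - v) + p (x - u) (y - v).
  rewrite -{1}(subrK u x) -{1}(subrK v y); move: (x - u) (y - v) => X' Y'.
  by rewrite pDl !pDr addrA addrK -addrA addrC.
have uw e : `|a + e| <= r + r ->
    `|p (f (a + e) - f a) (g (a + e) - g a)| <= C * (L * K) * `|e| ^+ 2.
  move=> aer; apply: le_trans (pN _ _) _.
  rewrite -mulrA ler_wpM2l// expr2 mulrACA ler_pM//.
    by apply: le_trans (fL _ _ _ _) _ => //; rewrite [a + e]addrC addrK.
  by apply: le_trans (gK _ _ _ _) _ => //; rewrite [a + e]addrC addrK.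
rewrite sdE (pE _ (g (a + d))) (pE _ (g (a - d))) addrACA.
rewrite [X in `|X + _|]addrACA.
rewrite -!pDl -!pDr -!sdE !mulrDl.
apply: le_trans (ler_normD _ _) _; apply: lerD.
  apply: le_trans (ler_normD _ _) _; apply: lerD.
    apply: le_trans (pN _ _) _; rewrite -!mulrA ler_wpM2l// (mulrC D) mulrA.
    by rewrite ler_pM// ?fS ?gD.
  apply: le_trans (pN _ _) _; rewrite -!mulrA ler_wpM2l//.
  by rewrite ler_pM// ?fB ?gT.
apply: le_trans (ler_normD _ _) _; apply: lerD; first exact: uw.
by rewrite -(normrN d); exact: uw.
Qed.

End BallRegularity.

(** * Bounds on balls for maps of class C^1 and C^2 *)

Section ClassC.
Context {R : realType}.
Implicit Types V W : normedModType R.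

Lemma is_derive_segment V W (f : V -> W) (a d : V) (s : R) :
  (forall w, differentiable f w) ->
  is_derive s 1 (fun t : R => f (a + t *: d)) ('d f (a + s *: d) d).
Proof.
move=> df; have dfs := df (a + s *: d).
have E : (fun h : R => h^-1 *: (((fun t : R => f (a + t *: d)) \o shift s) (h *: 1) -
    f (a + s *: d))) =
  (fun h : R => h^-1 *: ((f \o shift (a + s *: d)) (h *: d) - f (a + s *: d))).
  apply/funext => h /=; congr (_ *: (f _ - _)).
  by rewrite scalerDl [h *: 1]mulr1 addrCA.
split; first by rewrite /derivable E; exact: diff_derivable.
by rewrite /derive E -deriveE.
Qed.

Lemma diff_coordinates V W (f : V -> W) (I : finType) (b : I -> V) c w h :
  coordinates b c -> 'd f w h = \sum_i c i h *: 'd f w (b i).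
Proof.
move=> [bE _]; rewrite {1}[h]bE linear_sum.
by apply: eq_bigr => i _; rewrite linearZ.
Qed.

(** [class_C] only gives continuity of each directional derivative. Summing the norms of the
    derivatives along a finite basis gives a continuous bound of the operator norm. *)
Lemma diff_bounded_on_balls V W (f : V -> W) (r : R) :
  finite_coordinates V -> class_C 1 f ->
  exists2 B, 0 <= B & forall w h, `|w| <= r -> `|'d f w h| <= B * `|h|.
Proof.
move=> Vfin [_ dfc]; have [I [b [c bc]]] := Vfin.
have cN := coordinates_norm bc.
pose g w : R^o := \sum_i `|'d f w (b i)|.
have gc : continuous g.
  apply: (@continuous_big R^o I +%R 0 xpredT (@add_continuous R^o) V
    (index_enum I) (fun i w => `|'d f w (b i)| : R^o)) => i _ w.
  by apply: cvg_norm; exact: dfc.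
have [B B0 gB] := bounded_on_balls r Vfin gc.
exists B => // w h wr; rewrite (diff_coordinates _ _ _ bc).
apply: le_trans (ler_norm_sum _ _ _) _.
apply: (@le_trans _ _ (g w * `|h|)); last first.
  by rewrite ler_wpM2r// (le_trans (ler_norm _))// gB.
rewrite /g mulr_suml; apply: ler_sum => i _.
by rewrite normrZ mulrC ler_wpM2l.
Qed.

(** The mean value inequality along the segment from [b] to [a], which stays in the ball by
    convexity. *)
Lemma class_C1_lipschitz V W (f : V -> W) :
  finite_coordinates V -> finite_coordinates W -> class_C 1 f ->
  lipschitz_on_balls f.
Proof.
move=> Vfin Wfin fC r; have [B B0 fB] := diff_bounded_on_balls r Vfin fC.
exists B => // a b ar br; have df := fC.1.
pose phi (s : R) := f (b + s *: (a - b)).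
have := @mean_value_inequality _ W phi
  (fun s => 'd f (b + s *: (a - b)) (a - b)) 0 1 (B * `|a - b|) Wfin.
have -> : f a = phi 1 by rewrite /phi scale1r addrC subrK.
have -> : f b = phi 0 by rewrite /phi scale0r addr0.
rewrite subr0 mulr1; apply => //.
- by rewrite mulr_ge0.
- apply: derivable_within_continuous => s _.
  by have [] := is_derive_segment b (a - b) s df.
- by move=> s _; exact: is_derive_segment.
move=> s /andP[s0 s1]; apply: fB.
have -> : b + s *: (a - b) = (1 - s) *: b + s *: a.
  by rewrite scalerBr scalerBl scale1r addrCA -addrA addrC -addrA addrC.
have s1' : 0 <= 1 - s by rewrite subr_ge0 ltW.
rewrite (le_trans (ler_normD _ _))// !normrZ (ger0_norm s1') (ger0_norm (ltW s0)).
apply: le_trans (_ : (1 - s) * r + s * r <= _); last by rewrite -mulrDl subrK mul1r.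
by rewrite lerD// ler_wpM2l// ltW.
Qed.

Lemma class_CS V W (f : V -> W) k : class_C k.+1 f -> class_C k f.
Proof.
elim: k f => [f [df _] w|k IH f [df dfC]]; first exact: differentiable_continuous.
by split=> // h; exact: IH.
Qed.

(** Each derivative along a basis vector is of class C^1, hence Lipschitz on the ball; linearity in
    [h] sums these finitely many bounds. *)
Lemma diff_lipschitz_on_balls V W (f : V -> W) (r : R) :
  finite_coordinates V -> finite_coordinates W -> class_C 2 f ->
  exists2 L, 0 <= L & forall w w' h, `|w| <= r -> `|w'| <= r ->
    `|'d f w h - 'd f w' h| <= L * `|h| * `|w - w'|.
Proof.
move=> Vfin Wfin [_ dfC]; have [I [b [c bc]]] := Vfin.
have cN := coordinates_norm bc.
have /fin_all_exists[L HL] : forall i : I, exists L, 0 <= L /\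
    forall w w', `|w| <= r -> `|w'| <= r ->
    `|'d f w (b i) - 'd f w' (b i)| <= L * `|w - w'|.
  move=> i; have [L L0 HL] := class_C1_lipschitz Vfin Wfin (dfC (b i)) r.
  by exists L.
exists (\sum_i L i) => [|w w' h wr w'r].
  by apply: sumr_ge0 => i _; case: (HL i).
rewrite !(diff_coordinates _ _ h bc) -sumrB.
apply: le_trans (ler_norm_sum _ _ _) _.
rewrite !mulr_suml; apply: ler_sum => i _.
rewrite -scalerBr normrZ -mulrA mulrCA ler_pM//.
by case: (HL i) => _; exact.
Qed.

(** The mean value inequality on [[0, 1]] for [f (a + s d) + f (a - s d)], which starts at [2 f a].
    Its derivative is the difference of the differentials of [f] at two points [2 s |d|] apart,
    applied to [d]; this gives the factor 2. *)
Lemma class_C2_second_difference V W (f : V -> W) :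
  finite_coordinates V -> finite_coordinates W -> class_C 2 f ->
  second_difference_on_balls f.
Proof.
move=> Vfin Wfin fC r.
have [L L0 fL] := diff_lipschitz_on_balls (r + r) Vfin Wfin fC.
exists (L * 2) => [|a d ar dr]; first exact: mulr_ge0.
have df := fC.1.
have dphi (s : R) : is_derive s 1 (fun t : R => f (a + t *: d) + f (a + t *: - d))
   ('d f (a + s *: d) d + 'd f (a + s *: - d) (- d)).
  by apply: is_deriveD; exact: is_derive_segment.
have := @mean_value_inequality _ W _ _ 0 1 (L * 2 * `|d| ^+ 2) Wfin ler01 _ _
  (fun s _ => dphi s).
rewrite !scale1r !scale0r !addr0 subr0 mulr1 scaler_nat mulr2n; apply.
- by rewrite !mulr_ge0.
- apply: derivable_within_continuous => s _.
  by have [] := dphi s.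
move=> s /andP[/ltW s0 /ltW s1].
have r0 : 0 <= r by exact: le_trans ar.
have sdr : `|s *: d| <= r.
  rewrite normrZ ger0_norm// (le_trans _ dr)// ler_piMl//.
rewrite linearN; apply: le_trans (fL _ _ _ _ _) _.
- by rewrite (le_trans (ler_normD _ _))// lerD.
- by rewrite (le_trans (ler_normD _ _))// lerD// scalerN normrN.
rewrite -!mulrA ler_wpM2l// expr2 [leRHS]mulrCA ler_wpM2l//.
rewrite scalerN opprD opprK addrACA subrr add0r -scalerDl normrZ.
by rewrite ger0_norm ?addr_ge0// ler_wpM2r// lerD.
Qed.

End ClassC.

(** * Autonomous differential equations *)

Section Calculus.
Context {R : realType}.
Implicit Types V W : normedModType R.

(** The mean value inequality asks for continuity up to the end points, where no derivative is
    given; for the functions built from the solution it follows from Lipschitz bounds. *)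
Lemma lipschitz_within_continuous V (phi : R -> V) (a b M : R) : 0 <= M ->
  (forall s t, a <= s <= b -> a <= t <= b -> `|phi s - phi t| <= M * `|s - t|) ->
  {within `[a, b], continuous phi}.
Proof.
move=> M0 phiM; apply/subspace_continuousP => x /=; rewrite in_itv/= => xab.
apply/cvgrPdist_le => e e0; near=> t.
have tab : a <= t <= b by near: t; apply: withinT => t /=; rewrite in_itv.
apply: le_trans (phiM _ _ xab tab) _.
apply: le_trans (_ : (M + 1) * `|x - t| <= _); first by rewrite ler_wpM2r// lerDl.
rewrite mulrC -ler_pdivlMr ?ltr_wpDl//.
near: t; apply: (@cvgr_dist_le _ _ _ _ _ id); last by rewrite divr_gt0 ?ltr_wpDl.
exact: cvg_within.
Unshelve. all: by end_near. Qed.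

Lemma is_derive_affine V (phi : R -> V) (m k s : R) (d : V) :
  is_derive (m + k * s) 1 phi d ->
  is_derive s 1 (fun t => phi (m + k * t)) (k *: d).
Proof.
move=> [/derivable1_diffP phid phiE].
have gd : is_derive s 1 (fun t : R => m + k * t) k.
  have -> : (fun t : R => m + k * t) = cst m + k \*: id by [].
  by apply: is_derive_eq; rewrite add0r; exact: mulr1.
have gdiff : differentiable (fun t : R => m + k * t) s.
  by apply/derivable1_diffP; case: gd.
have cd : differentiable (phi \o (fun t : R => m + k * t)) s.
  exact: differentiable_comp.
split; first by apply/derivable1_diffP.
have gE : 'd (fun t : R => m + k * t) s 1 = k by rewrite -deriveE// derive_val.
rewrite deriveE// diff_comp//= gE -phiE deriveE//.
have -> : 'd phi (m + k * s) k = 'd phi (m + k * s) (k *: 1).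
  by rewrite [k *: 1]mulr1.
by rewrite linearZ.
Qed.

Lemma is_derive_scalel V (w : V) (s : R) : is_derive s 1 (fun t : R => t *: w) w.
Proof.
have E : (fun h : R => h^-1 *: (((fun t : R => t *: w) \o shift s) (h *: 1) -
    s *: w)) = (fun h : R => (h^-1 * h) *: w).
  apply/funext => h /=.
  by rewrite [h *: 1]mulr1 scalerDl addrK scalerA.
have H : (fun h : R => (h^-1 * h) *: w) @ 0^' --> w.
  apply: cvg_near_cst; near=> h; rewrite mulVf ?scale1r//.
  by near: h; exact: nbhs_dnbhs_neq.
split; first by rewrite /derivable E; apply/cvg_ex; exists w.
by rewrite /derive E; exact: cvg_lim.
Unshelve. all: by end_near. Qed.

Lemma mean_value_inequality_lipschitz V (phi dphi : R -> V) (a b K M : R) :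
  finite_coordinates V -> a <= b -> 0 <= K -> 0 <= M ->
  (forall s t, a <= s <= b -> a <= t <= b -> `|phi s - phi t| <= M * `|s - t|) ->
  (forall t, a < t < b -> is_derive t 1 phi (dphi t)) ->
  (forall t, a < t < b -> `|dphi t| <= K) ->
  `|phi b - phi a| <= K * (b - a).
Proof.
move=> Vfin ab K0 M0 phiM; apply: mean_value_inequality => //.
exact: lipschitz_within_continuous phiM.
Qed.

Lemma scale_bilinear_bounded V :
  bilinear_bounded (fun (k : R^o) (w : V) => k *: w) 1.
Proof.
by split=> // [a b c|a b c|a b]; rewrite ?scalerDl ?scalerDr ?normrZ ?mul1r.
Qed.

Lemma lipschitz_on_balls_linear V W (l : {linear V -> W}) (L : R) :
  0 <= L -> (forall w, `|l w| <= L * `|w|) -> lipschitz_on_balls l.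
Proof.
by move=> L0 lL; apply: (lipschitz_on_balls_global L0) => a b; rewrite -linearB.
Qed.

End Calculus.

(** * Bounds and quadrature estimates along an exact solution *)

Section AutonomousSolution.
Context {R : realType} (Y : normedModType R) (f : Y -> Y) (tf : R) (y : R -> Y).
Hypothesis Yfin : finite_coordinates Y.
Hypothesis f_lip : lipschitz_on_balls f.
Hypothesis tf_gt0 : 0 < tf.
Hypothesis y_cont : {within `[0, tf], continuous y}.
Hypothesis y_deriv : forall t, 0 < t < tf -> is_derive t 1 y (f (y t)).

Lemma solution_bounded :
  exists2 B, 0 <= B & forall t, 0 <= t <= tf -> `|y t| <= B.
Proof.
have /compact_bounded/ex_strict_bound_gt0[B B0 yB] : compact (y @` `[0, tf]).
  by apply: continuous_compact => //; exact: segment_compact.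
exists B; first exact: ltW.
by move=> t t0; apply/ltW/yB => /=; exists t => //=; rewrite in_itv.
Qed.

(** The solution stays in a ball, and a bound of [f] on that ball is a bound of the derivative. *)
Lemma solution_lipschitz : exists2 M, 0 <= M &
  forall s t, 0 <= s <= tf -> 0 <= t <= tf -> `|y s - y t| <= M * `|s - t|.
Proof.
have [B B0 yB] := solution_bounded.
have [M M0 fM] := lipschitz_on_balls_bounded B f_lip.
exists M => // s t; wlog st : s t / t <= s.
  move=> H s0 t0; have [ts|/ltW st] := leP t s; first exact: H.
  by rewrite distrC (distrC s); exact: H.
move=> /andP[s0 s1] /andP[t0 t1]; rewrite (ger0_norm (_ : 0 <= s - t)) ?subr_ge0//.
apply: (@mean_value_inequality _ _ _ (f \o y)) => //.
- apply: continuous_subspaceW y_cont => x /=; rewrite !in_itv/= => /andP[tx xs].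
  by rewrite (le_trans t0 tx) (le_trans xs s1).
- move=> x /andP[tx xs]; apply: y_deriv.
  by rewrite (le_lt_trans t0 tx) (lt_le_trans xs s1).
move=> x /andP[/ltW tx /ltW xs]; apply/fM/yB.
by rewrite (le_trans t0 tx) (le_trans xs s1).
Qed.

(** The mean value inequality for [y s - s *: f (y c)], whose derivative [f (y s) - f (y c)] is at
    most [L * M * (b - a)]. With [c = a] this is Euler's approximation forward in time, with [c = b]
    the one backward in time. *)
Lemma solution_first_order : exists2 C, 0 <= C &
  forall a c b, 0 <= a -> a <= c -> c <= b -> b <= tf ->
    `|y b - y a - (b - a) *: f (y c)| <= C * (b - a) ^+ 2.
Proof.
have [B B0 yB] := solution_bounded.
have [M M0 yM] := solution_lipschitz.
have [L L0 fL] := f_lip B.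
exists (L * M) => [|a c b a0 ac cb btf]; first exact: mulr_ge0.
have inI s : a <= s <= b -> 0 <= s <= tf.
  by move=> /andP[as_ sb]; rewrite (le_trans a0 as_) (le_trans sb btf).
have cI : 0 <= c <= tf by apply: inI; rewrite ac.
have ab := le_trans ac cb; have ba0 : 0 <= b - a by rewrite subr_ge0.
have -> : y b - y a - (b - a) *: f (y c) =
    (y b - b *: f (y c)) - (y a - a *: f (y c)).
  by rewrite scalerBl !opprB addrACA [in RHS]addrACA (addrC (- y a)).
rewrite expr2 mulrA.
apply: (@mean_value_inequality_lipschitz _ _ (fun s => y s - s *: f (y c))
  (fun s => f (y s) - f (y c)) _ _ _ (M + `|f (y c)|)) => //.
- by rewrite !mulr_ge0.
- by rewrite addr_ge0.
- move=> s t /inI sI /inI tI.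
  have -> : y s - s *: f (y c) - (y t - t *: f (y c)) =
      (y s - y t) - (s - t) *: f (y c).
    by rewrite scalerBl !opprB addrACA [in RHS]addrACA (addrC (- y t)).
  rewrite mulrDl (le_trans (ler_normB _ _))// lerD ?yM// normrZ mulrC.
  by rewrite ler_wpM2r.
- move=> s /andP[as_ sb]; apply: is_deriveB; last exact: is_derive_scalel.
  by apply: y_deriv; rewrite (le_lt_trans a0 as_) (lt_le_trans sb btf).
move=> s /andP[/ltW as_ /ltW sb].
have sI : 0 <= s <= tf by apply: inI; rewrite as_.
apply: le_trans (fL _ _ (yB _ sI) (yB _ cI)) _.
rewrite -mulrA ler_wpM2l//; apply: le_trans (yM _ _ sI cI) _.
rewrite ler_wpM2l// ler_norml opprB; apply/andP; split.
  exact: lerB.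
exact: lerB.
Qed.

(** The derivative of the auxiliary function is [f (y (m + s)) + f (y (m - s)) - 2 f (y m)].
    Replacing the solution by its tangent line at [m] costs [L * C1 * s ^+ 2] on each side, and what
    is left is a second difference of [f] with increment [s *: f (y m)]. *)
Lemma solution_midpoint : second_difference_on_balls f -> exists2 C, 0 <= C &
  forall m k, 0 <= k -> 0 <= m - k -> m + k <= tf ->
    `|y (m + k) - y (m - k) - (k *+ 2) *: f (y m)| <= C * k ^+ 3.
Proof.
move=> f_sd.
have [B B0 yB] := solution_bounded.
have [M M0 yM] := solution_lipschitz.
have [C1 C10 yC1] := solution_first_order.
have [F F0 fF] := lipschitz_on_balls_bounded B f_lip.
(* This ball contains the solution and the points of its tangent line at [m], as [s <= tf] and [f]
   is at most [F] along the solution. *)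
pose r := B + tf * F.
have r0 : 0 <= r by rewrite addr_ge0// mulr_ge0// ltW.
have [L L0 fL] := f_lip r; have [S S0 fS] := f_sd r.
exists (S * F ^+ 2 + L * C1 + L * C1) => [|m k k0 mk0 mktf].
  by rewrite !addr_ge0// !mulr_ge0.
have kI (s : R) : 0 <= s <= k -> (0 <= m + s <= tf) * (0 <= m - s <= tf).
  by move=> /andP[s0 sk]; split; apply/andP; split; lra.
have mI : 0 <= m <= tf by apply/andP; split; lra.
have ktf : k <= tf by lra.
pose w := f (y m); have wF : `|w| <= F by apply/fF/yB.
(* The coefficients [1] and [-1] put both arguments in the form that [is_derive_affine] expects. *)
pose phi s := y (m + 1 * s) - y (m + (-1) * s) - s *: (2 *: w).
have phi0 : phi 0 = 0 by rewrite /phi !mulr0 scale0r subrr subr0.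
have phik : phi k = y (m + k) - y (m - k) - (k *+ 2) *: w.
  by rewrite /phi mul1r mulN1r scalerA mulr_natr.
suff : `|phi k - phi 0| <= (S * F ^+ 2 + L * C1 + L * C1) * k ^+ 2 * (k - 0).
  by rewrite phi0 phik !subr0 -mulrA -exprSr.
apply: (@mean_value_inequality_lipschitz _ _ phi
  (fun s => 1 *: f (y (m + 1 * s)) - (-1) *: f (y (m + (-1) * s)) - 2 *: w)
  _ _ _ (M + M + `|2 *: w|)) => //.
- by rewrite !mulr_ge0// !addr_ge0// !mulr_ge0.
- by rewrite !addr_ge0.
- move=> s t /kI[s1 s2] /kI[t1 t2]; rewrite /phi !mul1r !mulN1r.
  have -> : y (m + s) - y (m - s) - s *: (2 *: w) -
      (y (m + t) - y (m - t) - t *: (2 *: w)) =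
      (y (m + s) - y (m + t)) - (y (m - s) - y (m - t)) - (s - t) *: (2 *: w).
    rewrite scalerBl !opprD !opprK !addrA.
    by rewrite [LHS](ACl (1*4*2*5*3*6)).
  rewrite !mulrDl (le_trans (ler_normB _ _))// lerD//; last first.
    by rewrite normrZ mulrC.
  rewrite (le_trans (ler_normB _ _))// lerD//.
    by rewrite (le_trans (yM _ _ s1 t1))// opprD addrACA subrr add0r.
  rewrite (le_trans (yM _ _ s2 t2))// opprD addrACA subrr add0r opprK.
  by rewrite addrC distrC.
- move=> s /andP[s0 sk]; apply: is_deriveB; last exact: is_derive_scalel.
  apply: is_deriveB; apply: is_derive_affine; apply: y_deriv;
    by apply/andP; split; lra.
move=> s /andP[/ltW s0 /ltW sk]; rewrite scale1r scaleN1r opprK mul1r mulN1r.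
have [s1 s2] : (0 <= m + s <= tf) * (0 <= m - s <= tf) by apply: kI; rewrite s0.
pose d := s *: w.
have dr : `|d| <= tf * F.
  by rewrite normrZ ger0_norm// ler_pM// (le_trans sk).
have Br : B <= r by rewrite lerDl mulr_ge0// ltW.
have mr : `|y m| <= r by rewrite (le_trans (yB _ mI)).
have ydr : `|y m + d| <= r by rewrite (le_trans (ler_normD _ _))// lerD// yB.
have ydr' : `|y m - d| <= r by rewrite (le_trans (ler_normB _ _))// lerD// yB.
have e1 : `|y (m + s) - (y m + d)| <= C1 * s ^+ 2.
  have := yC1 m m (m + s); rewrite [X in X - m]addrC addrK opprD addrA.
  by apply=> //; lra.
have e2 : `|y (m - s) - (y m - d)| <= C1 * s ^+ 2.
  have mE : m - (m - s) = s by ring.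
  by rewrite distrC addrAC; have := yC1 (m - s) m m; rewrite mE; apply=> //; lra.
have -> : f (y (m + s)) + f (y (m - s)) - 2 *: w =
  (f (y m + d) + f (y m - d) - 2 *: w) + (f (y (m + s)) - f (y m + d)) +
  (f (y (m - s)) - f (y m - d)).
  rewrite !addrA [RHS](ACl ((4*6*3)*(1*5)*(2*7)))/=.
  by rewrite !subrr !addr0.
have s2k : s ^+ 2 <= k ^+ 2 by rewrite ler_sqr.
rewrite !mulrDl; apply: le_trans (ler_normD _ _) _; apply: lerD.
  apply: le_trans (ler_normD _ _) _; apply: lerD.
    apply: le_trans (fS _ _ mr _) _.
      by rewrite (le_trans dr)// lerDr.
    rewrite -mulrA ler_wpM2l// /d normrZ exprMn (ger0_norm s0) mulrC.
    by rewrite ler_pM ?exprn_ge0// ler_sqr ?nnegrE.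
  apply: le_trans (fL _ _ _ ydr) _; first by rewrite (le_trans (yB _ _)).
  rewrite -mulrA ler_wpM2l// (le_trans e1)// ler_wpM2l//.
apply: le_trans (fL _ _ _ ydr') _; first by rewrite (le_trans (yB _ _)).
rewrite -mulrA ler_wpM2l// (le_trans e2)// ler_wpM2l//.
Qed.

End AutonomousSolution.

(** * The RK2-average step and its local truncation error *)

Section RK2Average.
Context {R : realType} (Y U : normedModType R).
Variables (pi : {linear Y -> U}) (G : Y * U -> Y).
Hypothesis pi_norm : forall y, `|pi y| <= `|y|.
Hypothesis G_lip : lipschitz_on_balls G.

(* Both stages evaluate the force at one state and pair it with another
   velocity, hence the second argument of G; the vector vector_field is G on the
   graph of pi. *)
Definition vector_field (y : Y) : Y := G (y, pi y).
Definition half_velocity (p : Y * R^o) : U :=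
  pi p.1 + (p.2 / 2) *: pi (vector_field p.1).
Definition half_state (p : Y * R^o) : Y :=
  p.1 + (p.2 / 2) *: G (p.1, half_velocity p).
(** The average of the old velocity [u] and the new one [u + h a], with [a] the acceleration at the
    half state, is [u + (h / 2) a]. *)
Definition mean_velocity (p : Y * R^o) : U :=
  pi p.1 + (p.2 / 2) *: pi (vector_field (half_state p)).
Definition slope (p : Y * R^o) : Y := G (half_state p, mean_velocity p).

Lemma lipschitz_on_balls_projection : lipschitz_on_balls pi.
Proof.
by apply: (@lipschitz_on_balls_linear _ _ _ _ 1) => // w; rewrite mul1r.
Qed.

Lemma lipschitz_on_balls_field : lipschitz_on_balls vector_field.
Proof.
apply: (lipschitz_on_balls_comp G_lip (lipschitz_on_balls_pair _ _)).
  exact: lipschitz_on_balls_id.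
exact: lipschitz_on_balls_projection.
Qed.

Lemma lipschitz_on_balls_half_scale (W : normedModType R) (g : Y * R^o -> W) :
  lipschitz_on_balls g ->
  lipschitz_on_balls (fun p : Y * R^o => (p.2 / 2 : R) *: g p).
Proof.
apply: (lipschitz_on_balls_bilinear (scale_bilinear_bounded W)).
apply: (@lipschitz_on_balls_global _ _ _ _ 1) => // a b.
rewrite mul1r -mulrBl normrM prod_normE le_max; apply/orP; right.
by rewrite ler_piMr// ger0_norm; lra.
Qed.

Lemma lipschitz_on_balls_half_velocity : lipschitz_on_balls half_velocity.
Proof.
apply: lipschitz_on_ballsD.
  exact: lipschitz_on_balls_comp lipschitz_on_balls_projection
    (@lipschitz_on_balls_fst _ _ _).
apply: lipschitz_on_balls_half_scale.
apply: lipschitz_on_balls_comp lipschitz_on_balls_projection _.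
exact: lipschitz_on_balls_comp lipschitz_on_balls_field
  (@lipschitz_on_balls_fst _ _ _).
Qed.

Lemma lipschitz_on_balls_half_state : lipschitz_on_balls half_state.
Proof.
apply: lipschitz_on_ballsD; first exact: lipschitz_on_balls_fst.
apply: lipschitz_on_balls_half_scale.
apply: (lipschitz_on_balls_comp G_lip (lipschitz_on_balls_pair _ _)).
  exact: lipschitz_on_balls_fst.
exact: lipschitz_on_balls_half_velocity.
Qed.

Lemma lipschitz_on_balls_mean_velocity : lipschitz_on_balls mean_velocity.
Proof.
apply: lipschitz_on_ballsD.
  exact: lipschitz_on_balls_comp lipschitz_on_balls_projection
    (@lipschitz_on_balls_fst _ _ _).
apply: lipschitz_on_balls_half_scale.
apply: lipschitz_on_balls_comp lipschitz_on_balls_projection _.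
exact: lipschitz_on_balls_comp lipschitz_on_balls_field
  lipschitz_on_balls_half_state.
Qed.

Lemma lipschitz_on_balls_slope : lipschitz_on_balls slope.
Proof.
apply: (lipschitz_on_balls_comp G_lip (lipschitz_on_balls_pair _ _)).
  exact: lipschitz_on_balls_half_state.
exact: lipschitz_on_balls_mean_velocity.
Qed.

Lemma half_velocity0 y : half_velocity (y, 0) = pi y.
Proof. by rewrite /half_velocity mul0r scale0r addr0. Qed.

Lemma half_state0 y : half_state (y, 0) = y.
Proof. by rewrite /half_state mul0r scale0r addr0. Qed.

Lemma slope0 y : slope (y, 0) = vector_field y.
Proof. by rewrite /slope half_state0 /mean_velocity mul0r scale0r addr0. Qed.

Lemma lipschitz_on_balls_at0 (W : normedModType R) (g : Y * R^o -> W) (r : R) :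
  lipschitz_on_balls g -> exists2 L, 0 <= L &
    forall y h, `|y| <= r -> 0 <= h <= r -> `|g (y, h) - g (y, 0)| <= L * h.
Proof.
move=> /(_ r)[L L0 gL]; exists L => // y h yr /andP[h0 hr].
have r0 := le_trans h0 hr.
apply: le_trans (gL _ _ _ _) _; rewrite ?prod_normE ?ge_max /= ?yr ?normr0//=.
  by rewrite ger0_norm.
by rewrite subrr subr0 normr0 (ger0_norm h0) max_r.
Qed.

Section Consistency.
Variables (tf : R) (y : R -> Y).
Hypothesis Yfin : finite_coordinates Y.
Hypothesis field_sd : second_difference_on_balls vector_field.
Hypothesis tf_gt0 : 0 < tf.
Hypothesis y_cont : {within `[0, tf], continuous y}.
Hypothesis y_deriv : forall t, 0 < t < tf -> is_derive t 1 y (vector_field (y t)).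

(** Let [m] be the midpoint of the step. An Euler half step reaches [y m] up to O(h^2). The velocity
    or state that the scheme uses inside its half step differs from the one at [t] by O(h) and
    enters with a factor [h / 2], again O(h^2). So [G] is evaluated O(h^2) away from
    [(y m, pi (y m))], and the midpoint rule applies. *)
Lemma local_truncation : exists2 C, 0 <= C & forall t h,
  0 <= t -> 0 <= h -> t + h <= tf ->
  `|y (t + h) - y t - h *: slope (y t, h)| <= C * h ^+ 3.
Proof.
have f_lip := lipschitz_on_balls_field.
have [B B0 yB] := solution_bounded y_cont.
have [C1 C10 yC1] := solution_first_order Yfin f_lip y_cont y_deriv.
have [C2 C20 yC2] := solution_midpoint Yfin f_lip tf_gt0 y_cont y_deriv field_sd.
pose r := B + tf; have r0 : 0 <= r by rewrite addr_ge0// ltW.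
have Br : B <= r by rewrite lerDl ltW.
have tr : tf <= r by rewrite lerDr.
have [H1 H10 hsB] := lipschitz_on_balls_bounded r lipschitz_on_balls_half_state.
have [H2 H20 mvB] := lipschitz_on_balls_bounded r lipschitz_on_balls_mean_velocity.
have [H3 H30 hvB] := lipschitz_on_balls_bounded r lipschitz_on_balls_half_velocity.
(* A radius for every argument at which [G] and the vector field are compared: the stages and the
   exact solution. *)
pose q := H1 + H2 + H3 + B.
have [LG LG0 GL] := G_lip q; have [Lf Lf0 fL] := f_lip q.
have [D1 D10 hsD] := lipschitz_on_balls_at0 r lipschitz_on_balls_half_state.
have [D2 D20 hvD] := lipschitz_on_balls_at0 r lipschitz_on_balls_half_velocity.
(* [C2] is the midpoint rule; the sum in parentheses bounds both the state error, with [LG * D2],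
   and the velocity error, with [Lf * D1]. *)
exists (C2 + LG * (C1 + LG * D2 + Lf * D1)) => [|t h t0 h0 th].
  by rewrite !addr_ge0// !mulr_ge0// !addr_ge0// !mulr_ge0.
pose k := h / 2; pose m := t + k.
have k0 : 0 <= k by rewrite /k; lra.
have hk : h = k *+ 2 by rewrite /k mulr2n; lra.
have tE : t = m - k by rewrite /m addrK.
have thE : t + h = m + k by rewrite /m hk mulr2n addrA.
have tI : 0 <= t <= tf by apply/andP; split; lra.
have mI : 0 <= m <= tf by apply/andP; rewrite /m /k; split; lra.
have hI : 0 <= h <= r by apply/andP; split; lra.
have ytr : `|y t| <= r by rewrite (le_trans (yB _ tI)).
have pr : `|(y t, h) : Y * R^o| <= r.
  by rewrite prod_normE ge_max ytr /= ger0_norm//; case/andP: hI.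
have mid : `|y (t + h) - y t - h *: vector_field (y m)| <= C2 * h ^+ 3.
  rewrite thE tE hk; apply: le_trans (yC2 m k _ _ _) _; rewrite -?tE -?thE//.
  rewrite ler_wpM2l// lerXn2r ?nnegrE// ?mulrn_wge0// mulr2n; lra.
have euler : `|y t + k *: vector_field (y t) - y m| <= C1 * h ^+ 2.
  have mE : m - t = k by rewrite /m addrC addKr.
  rewrite distrC opprD addrA; have := yC1 t t m; rewrite mE => H.
  apply: le_trans (H _ _ _ _) _; rewrite ?lexx//.
  - by rewrite /m; lra.
  - by case/andP: mI.
  by rewrite ler_wpM2l// lerXn2r ?nnegrE// /k; lra.
have kh : k <= h by rewrite /k; lra.
have qE : [/\ H1 <= q, H2 <= q, H3 <= q & B <= q].
  by rewrite /q; split; lra.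
case: qE => H1q H2q H3q Bq.
have ytq : `|y t| <= q by rewrite (le_trans (yB _ tI)).
have ymq : `|y m| <= q by rewrite (le_trans (yB _ mI)).
have hsq : `|half_state (y t, h)| <= q by rewrite (le_trans (hsB _ pr)).
have insertE (a b c d : Y) : a + d - c = a + b - c + (d - b).
  by rewrite [RHS]addrAC; congr (_ - c); rewrite -addrA (addrC b) subrK.
have stateE : `|half_state (y t, h) - y m| <= (C1 + LG * D2 + Lf * D1) * h ^+ 2.
  have -> : half_state (y t, h) - y m = (y t + k *: vector_field (y t) - y m) +
      k *: (G (y t, half_velocity (y t, h)) - vector_field (y t)).
    by rewrite scalerBr -insertE.
  apply: (@le_trans _ _ (C1 * h ^+ 2 + LG * D2 * h ^+ 2)); last first.
    by rewrite !mulrDl lerDl !mulr_ge0.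
  rewrite (le_trans (ler_normD _ _))// lerD//.
  rewrite normrZ (ger0_norm k0) expr2 mulrCA ler_pM//.
  apply: le_trans (GL _ _ _ _) _.
  - by rewrite prod_normE ge_max /= ytq (le_trans (hvB _ pr)).
  - by rewrite prod_normE ge_max /= ytq (le_trans (pi_norm _)).
  rewrite -mulrA ler_wpM2l// prod_normE /= subrr normr0 max_r//.
  by rewrite -half_velocity0; exact: hvD.
have velE :
    `|mean_velocity (y t, h) - pi (y m)| <= (C1 + LG * D2 + Lf * D1) * h ^+ 2.
  have -> : mean_velocity (y t, h) - pi (y m) =
      pi ((y t + k *: vector_field (y t) - y m) +
          k *: (vector_field (half_state (y t, h)) - vector_field (y t))).
    by rewrite scalerBr -insertE linearB linearD linearZ.
  apply: (@le_trans _ _ (C1 * h ^+ 2 + Lf * D1 * h ^+ 2)); last first.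
    by rewrite !mulrDl [leRHS]addrAC lerDl !mulr_ge0.
  rewrite (le_trans (pi_norm _))// (le_trans (ler_normD _ _))// lerD//.
  rewrite normrZ (ger0_norm k0) expr2 mulrCA ler_pM//.
  apply: le_trans (fL _ _ hsq ytq) _.
  by rewrite -mulrA ler_wpM2l// -{2}(half_state0 (y t)); exact: hsD.
have slopeE : `|slope (y t, h) - vector_field (y m)| <=
    LG * (C1 + LG * D2 + Lf * D1) * h ^+ 2.
  apply: le_trans (GL _ _ _ _) _.
  - by rewrite prod_normE ge_max /= hsq (le_trans (mvB _ pr)).
  - by rewrite prod_normE ge_max /= ymq (le_trans (pi_norm _)).
  by rewrite -mulrA ler_wpM2l// prod_normE ge_max stateE velE.
have -> : y (t + h) - y t - h *: slope (y t, h) =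
    (y (t + h) - y t - h *: vector_field (y m)) -
    h *: (slope (y t, h) - vector_field (y m)).
  by rewrite scalerBr opprB [RHS]addrA subrK.
rewrite mulrDl (le_trans (ler_normB _ _))// lerD//.
by rewrite normrZ (ger0_norm h0) exprS mulrCA ler_wpM2l.
Qed.

End Consistency.
End RK2Average.

(** * Convergence of one-step methods *)

Section Grid.
Context {R : realType}.
Variables (tf : R) (M : nat) (t : nat -> R).
Hypothesis grid : temporal_grid tf M t.

Lemma grid_le_tf n : (n <= M)%N -> t n <= tf.
Proof.
case: grid => _ <- t_lt nM; rewrite -[in leRHS](subnKC nM).
have: (n + (M - n) <= M)%N by rewrite subnKC.
elim: (M - n)%N => [|k IH]; first by rewrite addn0.
by rewrite addnS => nkM; rewrite (le_trans (IH (ltnW nkM)))// ltW// t_lt.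
Qed.

Lemma grid_ge0 n : (n <= M)%N -> 0 <= t n.
Proof.
case: grid => t0 _ t_lt; elim: n => [|n IH nM]; first by rewrite t0.
by rewrite (le_trans (IH (ltnW nM)))// ltW// t_lt.
Qed.

Lemma step_gt0 n : (n < M)%N -> 0 < t n.+1 - t n.
Proof. by case: grid => _ _ t_lt nM; rewrite subr_gt0 t_lt. Qed.

Lemma step_le_max n : (n < M)%N -> t n.+1 - t n <= max_step M t.
Proof.
move=> nM; rewrite /max_step.
exact: (le_bigmax_cond _ (fun j : 'I_M => t j.+1 - t j) (j := Ordinal nM)).
Qed.

Lemma max_step_ge0 : 0 <= max_step M t.
Proof. exact: bigmax_ge_id. Qed.

End Grid.

(** Induction step of the discrete Gronwall inequality: [1 + L * h] is at most [expR (L * h)], and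
    the new defect [k * h] may be enlarged by the factor [expR (L * (t + h))]. *)
Lemma gronwall_step (R : realType) (L k a0 a a1 t h : R) :
  0 <= L -> 0 <= k -> 0 <= t -> 0 <= h -> 0 <= a0 ->
  a1 <= (1 + L * h) * a + k * h ->
  a <= expR (L * t) * (a0 + k * t) ->
  a1 <= expR (L * (t + h)) * (a0 + k * (t + h)).
Proof.
move=> L0 k0 t0 h0 a00 a1E aE; apply: le_trans a1E _.
have X0 : 0 <= expR (L * t) * (a0 + k * t).
  by rewrite mulr_ge0 ?expR_ge0// addr_ge0// mulr_ge0.
apply: (@le_trans _ _ (expR (L * h) * (expR (L * t) * (a0 + k * t)) +
    expR (L * (t + h)) * (k * h))).
  apply: lerD.
    apply: (@le_trans _ _ ((1 + L * h) * (expR (L * t) * (a0 + k * t)))).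
      by rewrite ler_wpM2l// addr_ge0// mulr_ge0.
    by rewrite ler_wpM2r// expR_ge1Dx.
  rewrite ler_peMl ?mulr_ge0// -expR0 ler_expR mulr_ge0//.
  exact: addr_ge0.
rewrite (mulrDr L) expRD; rewrite le_eqVlt; apply/predU1P; left; ring.
Qed.

(** * Error propagation for a slope that is Lipschitz on balls *)

Section OneStepMethod.
Context {R : realType} (Y : normedModType R) (N : Y -> R).
Variables (slope : Y * R^o -> Y) (tf : R) (y : R -> Y) (Cn Lf Ct B : R).
Hypothesis ND : forall a b, N (a + b) <= N a + N b.
Hypothesis NZ : forall k a, N (k *: a) = `|k| * N a.
Hypothesis N_le : forall a, N a <= Cn * `|a|.
Hypothesis norm_le : forall a, `|a| <= Cn * N a.
Hypothesis Cn_gt0 : 0 < Cn.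
Hypothesis slope_lip : lipschitz_on_balls slope.
Hypothesis Lf_ge0 : 0 <= Lf.
Hypothesis field_lip : forall a b,
  N (slope (a, 0) - slope (b, 0)) <= Lf * N (a - b).
Hypothesis tf_gt0 : 0 < tf.
Hypothesis B_ge0 : 0 <= B.
Hypothesis y_bounded : forall t, 0 <= t <= tf -> `|y t| <= B.
Hypothesis Ct_ge0 : 0 <= Ct.
Hypothesis truncation : forall t h, 0 <= t -> 0 <= h -> t + h <= tf ->
  `|y (t + h) - y t - h *: slope (y t, h)| <= Ct * h ^+ 3.

Definition one_step_run (t : nat -> R) (z : nat -> Y) : Prop :=
  forall n, z n.+1 = z n + (t n.+1 - t n) *: slope (z n, t n.+1 - t n).

Let Cn_ge0 : 0 <= Cn. Proof. exact: ltW. Qed.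

Lemma seminorm_ge0 a : 0 <= N a.
Proof. by rewrite -(pmulr_rge0 _ Cn_gt0) (le_trans _ (norm_le a)). Qed.

(** Inserting the numerical step that starts from the exact value [y t] separates the propagated
    error from the local truncation error. *)
Lemma one_step_error t h z : 0 <= t -> 0 <= h -> t + h <= tf ->
  N (y (t + h) - (z + h *: slope (z, h))) <=
  N (y t - z) + h * N (slope (y t, h) - slope (z, h)) + Cn * (Ct * h ^+ 3).
Proof.
move=> t0 h0 th.
have -> : y (t + h) - (z + h *: slope (z, h)) =
    (y t - z) + h *: (slope (y t, h) - slope (z, h)) +
    (y (t + h) - y t - h *: slope (y t, h)).
  rewrite scalerBr opprD !addrA [RHS](ACl ((5*2*4)*(1*6)*(3*7)))/=.
  by rewrite !subrr !addr0.
apply: le_trans (ND _ _) _; apply: lerD.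
  by apply: le_trans (ND _ _) _; rewrite NZ (ger0_norm h0).
by apply: le_trans (N_le _) _; rewrite ler_wpM2l// truncation.
Qed.

(** [slope] is bounded on each ball, so the ball containing the iterates can be enlarged step by
    step. The bound depends on the grid and on [r], but is common to all runs that start within
    [r]. *)
Lemma run_bounded (M : nat) (t : nat -> R) (r : R) :
  temporal_grid tf M t ->
  exists2 E, 0 <= E & forall z, one_step_run t z -> N (y (t 0%N) - z 0%N) <= r ->
    forall n, (n <= M)%N -> N (y (t n) - z n) <= E.
Proof.
move=> grid.
have zB n : exists2 E, 0 <= E & forall z, one_step_run t z ->
    N (y (t 0%N) - z 0%N) <= r -> forall m, (m <= n)%N -> `|z m| <= E.
  elim: n => [|n [E E0 zE]].
    exists (B + Cn * `|r|) => [|z _ z0 m]; first by rewrite addr_ge0// mulr_ge0.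
    rewrite leqn0 => /eqP->; rewrite -[z 0%N](subKr (y (t 0%N))).
    rewrite (le_trans (ler_normB _ _))// lerD//.
      by apply: y_bounded; rewrite (grid_ge0 grid)// (grid_le_tf grid).
    apply: le_trans (norm_le _) _; rewrite ler_wpM2l//.
    exact: le_trans z0 (ler_norm _).
  pose h := t n.+1 - t n.
  have [S S0 sS] := lipschitz_on_balls_bounded (E + `|h|) slope_lip.
  exists (E + `|h| * S) => [|z zr z0 m].
    by rewrite addr_ge0// mulr_ge0.
  rewrite leq_eqVlt => /predU1P[->|mn]; last first.
    by rewrite (le_trans (zE _ zr z0 m mn))// lerDl mulr_ge0.
  rewrite zr -/h (le_trans (ler_normD _ _))// lerD ?zE// normrZ ler_wpM2l//.
  by apply: sS; rewrite prod_normE ge_max /= ler_wpDr ?zE//= ler_wpDl.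
have [E E0 zE] := zB M.
exists (Cn * (B + E)) => [|z zr z0 n nM]; first by rewrite mulr_ge0// addr_ge0.
apply: le_trans (N_le _) _; rewrite ler_wpM2l// (le_trans (ler_normB _ _))//.
rewrite lerD ?zE// y_bounded//.
by rewrite (grid_ge0 grid)// (grid_le_tf grid).
Qed.

Lemma one_step_convergence (r : R) : exists C0 h0 : R, 0 < C0 /\ 0 < h0 /\
  forall (M : nat) (t : nat -> R), temporal_grid tf M t -> max_step M t <= h0 ->
  forall z, one_step_run t z -> N (y (t 0%N) - z 0%N) <= r ->
  forall n, (n <= M)%N -> N (y (t n) - z n) <=
    expR (C0 * t n) * (N (y (t 0%N) - z 0%N) + C0 * max_step M t ^+ 2).
Proof.
(* Radius of the tube: the first-order Gronwall bound at time [tf] with initial error at most [|r|]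
   and accumulated defect at most 1. It contains only the global constant [Lf], so it can be fixed
   before the Lipschitz constant [Ls] on the tube is known. *)
pose rho := expR (Lf * tf) * (`|r| + 1).
have rho0 : 0 <= rho by rewrite mulr_ge0 ?expR_ge0.
(* The ball of radius [q] contains the tube, and also the pairs of a state and a step size at most
   1. *)
pose q := B + Cn * rho + 1.
have q1 : 1 <= q by rewrite lerDr addr_ge0// mulr_ge0.
have Bq : B <= q by rewrite /q -addrA lerDl addr_ge0// mulr_ge0.
have [Ls Ls0 sL] := slope_lip q.
(* Defect of the first-order estimate: replacing step size [h] by 0 in the slope at the exact and at
   the numerical value, and the truncation error. *)
pose K := Cn * Ls + Cn * Ls + Cn * Ct.
have K0 : 0 <= K by rewrite !addr_ge0// mulr_ge0.
have Ktf0 : 0 <= K * tf by rewrite mulr_ge0// ltW.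
(* It dominates the growth rate [Cn * Ls * Cn] in the tube and the truncation error accumulated up
   to [tf]. *)
pose C0 := 1 + Cn * Ls * Cn + Cn * Ct * tf.
(* Chosen so that [h0 <= 1] and the accumulated first-order defect [K * h0 * tf] is at most 1, as
   [rho] allows. *)
pose h0 := (1 + K * tf)^-1.
have h00 : 0 < h0 by rewrite invr_gt0 ltr_pwDl.
have h01 : h0 <= 1 by rewrite invf_le1 ?ltr_pwDl// lerDl.
have Kh0 : K * h0 * tf <= 1.
  by rewrite mulrAC ler_pdivrMr ?ltr_pwDl// mul1r lerDr.
have L20 : 0 <= Cn * Ls * Cn by rewrite !mulr_ge0.
have CC0 : 0 <= Cn * Ct * tf by rewrite !mulr_ge0// ltW.
exists C0, h0; split; first by rewrite /C0 -addrA ltr_pwDl// addr_ge0.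
split=> // M t grid mh z zr z0.
have m0 := max_step_ge0 M t.
have t_0 : t 0%N = 0 by case: grid.
set e := fun n => N (y (t n) - z n).
have e0 n : 0 <= e n by exact: seminorm_ge0.
pose h n := t n.+1 - t n.
have step n : (n < M)%N -> [/\ 0 <= h n, h n <= 1, h n <= max_step M t &
    t n.+1 = t n + h n].
  move=> nM; have hm := step_le_max t nM.
  split=> //; first by rewrite ltW// (step_gt0 grid).
    by rewrite (le_trans hm)// (le_trans mh).
  by rewrite addrC subrK.
have stepE n : (n < M)%N -> e n.+1 <= e n +
    h n * N (slope (y (t n), h n) - slope (z n, h n)) + Cn * (Ct * h n ^+ 3).
  move=> nM; have [hn0 hn1 hnm tE] := step n nM.
  rewrite /e zr -/(h n) tE; apply: one_step_error => //.
    by rewrite (grid_ge0 grid)// ltnW.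
  by rewrite -tE (grid_le_tf grid).
have tube n : (n < M)%N -> e n <= rho -> `|z n| <= q /\ `|y (t n)| <= q.
  move=> nM en.
  have yB : `|y (t n)| <= B.
    by apply: y_bounded; rewrite (grid_ge0 grid) ?(grid_le_tf grid)// ltnW.
  split; last exact: le_trans yB Bq.
  rewrite -[z n](subKr (y (t n))) (le_trans (ler_normB _ _))//.
  rewrite /q -addrA lerD// ler_wpDr//.
  by apply: le_trans (norm_le _) _; rewrite ler_wpM2l.
have in_ball x s : `|x| <= q -> 0 <= s <= 1 -> `|(x, s) : Y * R^o| <= q.
  move=> xq /andP[s0 s1].
  by rewrite prod_normE ge_max xq /= ger0_norm// (le_trans s1).
(* Comparison through step size 0 gives the rate [Lf]; the constant [Ls] enters only the defect. *)
have first_order n : (n < M)%N -> e n <= rho ->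
    e n.+1 <= (1 + Lf * h n) * e n + K * max_step M t * h n.
  move=> nM en; have [hn0 hn1 hnm _] := step n nM.
  have [zq yq] := tube n nM en.
  have at0 x : `|x| <= q -> N (slope (x, h n) - slope (x, 0)) <= Cn * (Ls * h n).
    move=> xq; apply: le_trans (N_le _) _; rewrite ler_wpM2l//.
    apply: le_trans (sL _ _ _ _) _; rewrite ?in_ball ?hn0 ?lexx ?ler01//.
    by rewrite prod_normE /= subrr normr0 subr0 ger0_norm// max_r.
  have sE : N (slope (y (t n), h n) - slope (z n, h n)) <=
      Lf * e n + (Cn * (Ls * h n) + Cn * (Ls * h n)).
    have -> : slope (y (t n), h n) - slope (z n, h n) =
       (slope (y (t n), 0) - slope (z n, 0)) +
       ((slope (y (t n), h n) - slope (y (t n), 0)) +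
        (-1) *: (slope (z n, h n) - slope (z n, 0))).
      rewrite scaleN1r opprB !addrA [RHS](ACl ((3*6)*(1*4)*(2*5)))/=.
      by rewrite subrr (addrC (- _)) subrr !addr0.
    apply: le_trans (ND _ _) _; rewrite lerD// (le_trans (ND _ _))//.
    by rewrite NZ normrN1 mul1r lerD// at0.
  have h3 : h n ^+ 3 <= h n * h n.
    by rewrite exprS ler_wpM2l// expr2 ler_piMr.
  apply: le_trans (stepE n nM) _.
  apply: (@le_trans _ _ (e n + h n * (Lf * e n + (Cn * (Ls * h n) +
    Cn * (Ls * h n))) + Cn * (Ct * (h n * h n)))).
    apply: lerD; first by rewrite lerD2l ler_wpM2l.
    by rewrite ler_wpM2l// ler_wpM2l.
  have -> : e n + h n * (Lf * e n + (Cn * (Ls * h n) + Cn * (Ls * h n))) +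
      Cn * (Ct * (h n * h n)) = (1 + Lf * h n) * e n + K * h n * h n.
    by rewrite /K; ring.
  by rewrite lerD2l ler_wpM2r// ler_wpM2l.
(* Comparison at the same step size leaves only the truncation error as defect; the rate now depends
   on the tube. *)
have second_order n : (n < M)%N -> e n <= rho ->
    e n.+1 <= (1 + Cn * Ls * Cn * h n) * e n + Cn * Ct * max_step M t ^+ 2 * h n.
  move=> nM en; have [hn0 hn1 hnm _] := step n nM.
  have [zq yq] := tube n nM en.
  have sE : N (slope (y (t n), h n) - slope (z n, h n)) <= Cn * (Ls * (Cn * e n)).
    apply: le_trans (N_le _) _; rewrite ler_wpM2l//.
    apply: le_trans (sL _ _ _ _) _; rewrite ?in_ball ?hn0//.
    rewrite ler_wpM2l// prod_normE /= subrr normr0 max_l//; exact: norm_le.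
  apply: le_trans (stepE n nM) _.
  apply: (@le_trans _ _ (e n + h n * (Cn * (Ls * (Cn * e n))) +
      Cn * (Ct * (max_step M t ^+ 2 * h n)))).
    apply: lerD; first by rewrite lerD2l ler_wpM2l.
    by rewrite ler_wpM2l// ler_wpM2l// exprSr ler_wpM2r// ler_sqr ?nnegrE.
  by rewrite le_eqVlt; apply/predU1P; left; ring.
have e0r : e 0%N <= `|r| by exact: le_trans z0 (ler_norm _).
(* The bound and the confinement go through one induction, since each step estimate presupposes that
   the previous error is within [rho]. *)
have confined n : (n <= M)%N ->
    e n <= expR (Lf * t n) * (e 0%N + K * max_step M t * t n) /\ e n <= rho.
  have to_rho m : (m <= M)%N ->
      e m <= expR (Lf * t m) * (e 0%N + K * max_step M t * t m) -> e m <= rho.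
    move=> mM; move/le_trans; apply.
    have tm0 := grid_ge0 grid mM; have tmf := grid_le_tf grid mM.
    rewrite ler_pM ?expR_ge0 ?addr_ge0 ?mulr_ge0//.
      by rewrite ler_expR ler_wpM2l.
    rewrite lerD// (le_trans _ Kh0)// ler_pM ?mulr_ge0//.
    by rewrite ler_wpM2l.
  elim: n => [|n IH nM].
    split; first by rewrite t_0 !mulr0 addr0 expR0 mul1r.
    by apply: to_rho => //; rewrite t_0 !mulr0 addr0 expR0 mul1r.
  have [IH1 IH2] := IH (ltnW nM); have [hn0 hn1 hnm tE] := step n nM.
  suff H : e n.+1 <= expR (Lf * t n.+1) * (e 0%N + K * max_step M t * t n.+1).
    by split=> //; exact: to_rho.
  rewrite tE; apply: gronwall_step IH1 => //; first by rewrite mulr_ge0.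
    by rewrite (grid_ge0 grid)// ltnW.
  exact: first_order.
move=> n nM.
have {nM} nMt : (n <= M)%N /\ 0 <= t n <= tf.
  by rewrite (grid_ge0 grid) ?(grid_le_tf grid).
have {}nM := nMt.1; have /andP[tn0 tnf] := nMt.2.
have main : e n <= expR (Cn * Ls * Cn * t n) *
    (e 0%N + Cn * Ct * max_step M t ^+ 2 * t n).
  elim: n nM {nMt tn0 tnf} => [_|n IH nM].
    by rewrite t_0 !mulr0 addr0 expR0 mul1r.
  have [hn0 hn1 hnm tE] := step n nM.
  rewrite tE; apply: gronwall_step (IH (ltnW nM)) => //.
  - by rewrite !mulr_ge0// sqr_ge0.
  - by rewrite (grid_ge0 grid)// ltnW.
  - by apply: second_order => //; case: (confined n (ltnW nM)).
apply: le_trans main _; rewrite ler_pM ?expR_ge0//.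
- by rewrite addr_ge0// !mulr_ge0// sqr_ge0.
- rewrite ler_expR ler_wpM2r// /C0 (addrC 1) -addrA lerDl.
  by rewrite addr_ge0.
rewrite lerD2l mulrAC ler_wpM2r ?sqr_ge0//.
apply: (@le_trans _ _ (Cn * Ct * tf)); first by rewrite ler_wpM2l// mulr_ge0.
by rewrite lerDr addr_ge0.
Qed.

Theorem one_step_error_bound (r : R) : exists C0 h0 : R, 0 < C0 /\ 0 < h0 /\
  forall (M : nat) (t : nat -> R), temporal_grid tf M t ->
  exists C, 0 < C /\ (max_step M t <= h0 -> C = C0) /\
  forall z, one_step_run t z -> N (y (t 0%N) - z 0%N) <= r ->
  forall n, (n <= M)%N -> N (y (t n) - z n) <=
    expR (C * t n) * (N (y (t 0%N) - z 0%N) + C * max_step M t ^+ 2).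
Proof.
have [C0 [h0 [C00 [h00 H]]]] := one_step_convergence r.
exists C0, h0; split=> //; split=> // M t grid.
have [mh|hm] := leP (max_step M t) h0.
  by exists C0; split=> //; split=> //; exact: H.
have m0 : 0 < max_step M t by exact: lt_trans hm.
have [E E0 zE] := run_bounded r grid.
have EC : 0 <= E / max_step M t ^+ 2 by rewrite divr_ge0// sqr_ge0.
(* With this constant the term [C * max_step M t ^+ 2] alone exceeds the bound [E] of all the
   errors. *)
exists (1 + E / max_step M t ^+ 2); split; first by rewrite ltr_pwDl.
split=> //.
move=> z zr z0 n nM; apply: le_trans (zE z zr z0 n nM) _.
have tn0 := grid_ge0 grid nM.
apply: (@le_trans _ _ (1 * (0 + (1 + E / max_step M t ^+ 2) * max_step M t ^+ 2))).
  have m2 : max_step M t ^+ 2 != 0 by rewrite gt_eqF// exprn_gt0.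
  by rewrite mul1r add0r mulrDl divfK// lerDr mulr_ge0 ?sqr_ge0.
have P0 : 0 <= (1 + E / max_step M t ^+ 2) * max_step M t ^+ 2.
  by rewrite mulr_ge0 ?sqr_ge0// addr_ge0.
rewrite ler_pM ?add0r//; last by rewrite lerDr seminorm_ge0.
by rewrite -expR0 ler_expR mulr_ge0// addr_ge0.
Qed.

End OneStepMethod.

(** * The reduced order model *)

(** The Cauchy-Schwarz inequality for a semidefinite form follows from its nonnegativity at a
    suitable combination of [a] and [b], and the triangle inequality from it by squaring. *)
Lemma psd_form_triangle (R : realType) (V : lmodType R) (q : V -> V -> R) :
  (forall a b, q a b = q b a) ->
  (forall a b c, q (a + b) c = q a c + q b c) ->
  (forall k a b, q (k *: a) b = k * q a b) ->
  (forall a, 0 <= q a a) ->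
  forall a b, Num.sqrt (q (a + b) (a + b)) <= Num.sqrt (q a a) + Num.sqrt (q b b).
Proof.
move=> qC qDl qZl q0 a b.
have qE x y : q (x *: a + y *: b) (x *: a + y *: b) =
    x ^+ 2 * q a a + 2 * (x * y) * q a b + y ^+ 2 * q b b.
  rewrite qDl !(qC _ (_ + _)) !qDl !qZl (qC _ (_ *: _)) (qC b (x *: a)) !qZl.
  rewrite (qC b (y *: b)) (qC a (y *: b)) !qZl (qC b a); ring.
have CS : q a b ^+ 2 <= q a a * q b b.
  have [b0|b0] := eqVneq (q b b) 0.
    (* If [q b b = 0], the value here is [- (q a a + 2) * q a b ^+ 2], which forces [q a b = 0]. *)
    have := q0 (q a b *: a + (- (q a a + 1)) *: b).
    rewrite qE b0 !mulr0 addr0 => H.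
    have : 0 <= - ((q a a + 2) * q a b ^+ 2).
      by apply: le_trans H _; rewrite le_eqVlt; apply/predU1P; left; ring.
    by rewrite oppr_ge0 pmulr_rle0// ltr_wpDl.
  have b1 : 0 < q b b by rewrite lt_neqAle eq_sym b0 q0.
  have := q0 (q b b *: a + (- q a b) *: b).
  rewrite qE (_ : _ + _ = q b b * (q a a * q b b - q a b ^+ 2)); last by ring.
  by rewrite pmulr_rge0// subr_ge0.
rewrite -[leRHS]ger0_norm ?addr_ge0 ?sqrtr_ge0// -sqrtr_sqr ler_wsqrtr//.
have -> : q (a + b) (a + b) = q a a + 2 * q a b + q b b.
  by have := qE 1 1; rewrite !scale1r => ->; ring.
have qss : q a b <= Num.sqrt (q a a) * Num.sqrt (q b b).
  by rewrite -sqrtrM// (le_trans (ler_norm _))// -sqrtr_sqr ler_wsqrtr.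
by rewrite sqrrD !sqr_sqrtr//; lra.
Qed.

(** * Matrix products in the sup norm and positive definite matrices *)

Section MatrixMaps.
Context {R : realType}.

(** The sup norm is not submultiplicative; each entry is a sum of [n] products, hence the factor. *)
Lemma mulmx_norm m n p (A : 'M[R]_(m, n)) (B : 'M[R]_(n, p)) :
  `|A *m B| <= n%:R * (`|A| * `|B|).
Proof.
have nAB : 0 <= n%:R * (`|A| * `|B|) by rewrite !mulr_ge0.
apply/(mx_norm_leP _ nAB) => i j; rewrite mxE.
apply: le_trans (ler_norm_sum _ _ _) _.
apply: (@le_trans _ _ (\sum_(k < n) `|A| * `|B|)).
  by apply: ler_sum => k _; rewrite normrM ler_pM// mx_entry_norm.
by rewrite sumr_const card_ord mulr_natl.
Qed.

Lemma mulmx_bilinear_bounded m n p :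
  bilinear_bounded (fun (A : 'M[R]_(m, n)) (B : 'M[R]_(n, p)) => A *m B) n%:R.
Proof.
by split=> // *; rewrite ?mulmxDl ?mulmxDr// mulmx_norm.
Qed.

Lemma mulmx_linear_bounded m n p (A : 'M[R]_(m, n)) (B : 'M[R]_(n, p)) :
  `|mulmx A B| <= n%:R * `|A| * `|B|.
Proof. by rewrite -mulrA mulmx_norm. Qed.

Lemma mulmxr_linear_bounded m n p (B : 'M[R]_(n, p)) (A : 'M[R]_(m, n)) :
  `|mulmxr B A| <= n%:R * `|B| * `|A|.
Proof. by rewrite -mulrA (mulrC `|B|) mulmx_norm. Qed.

Lemma trmx_linear_bounded m n (A : 'M[R]_(m, n)) : `|A^T| <= 1 * `|A|.
Proof.
rewrite mul1r; apply/mx_norm_leP => // i j.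
by rewrite mxE mx_entry_norm.
Qed.

Lemma norm_le_euclid n (u : 'cV[R]_n) : `|u| <= euclid_norm u.
Proof.
apply/mx_norm_leP; first exact: sqrtr_ge0.
move=> i j; rewrite (ord1 j) /euclid_norm -sqrtr_sqr ler_wsqrtr//.
by rewrite (bigD1 i)//= lerDl sumr_ge0// => k _; exact: sqr_ge0.
Qed.

Lemma spd_ge0 n (M : 'M[R]_n) (u : 'cV[R]_n) : spd M -> 0 <= (u^T *m M *m u) 0 0.
Proof.
move=> [_ Mpos]; have [->|u0] := eqVneq u 0; first by rewrite mulmx0 mxE.
exact/ltW/Mpos.
Qed.

(** For a row [u] in the kernel the form of [M] vanishes at [Phi *m u^T]; definiteness makes this
    vector 0, and orthonormality of the columns then gives [u = 0]. *)
Lemma spd_reduced_unit m n (M : 'M[R]_m) (Phi : 'M[R]_(m, n)) :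
  spd M -> Phi^T *m Phi = 1%:M -> Phi^T *m M *m Phi \in unitmx.
Proof.
move=> [_ Mpos] PhiI; rewrite -row_free_unit -kermx_eq0.
apply/eqP/row_matrixP => i; rewrite row0.
set u := row i _; have uA : u *m (Phi^T *m M *m Phi) = 0.
  by rewrite -row_mul mulmx_ker row0.
have w0 : Phi *m u^T = 0.
  apply/eqP; apply: contraT => /Mpos.
  by rewrite trmx_mul trmxK !mulmxA in uA *; rewrite uA mul0mx mxE ltxx.
by rewrite -[u]trmxK -[u^T]mul1mx -PhiI -mulmxA w0 mulmx0 trmx0.
Qed.

End MatrixMaps.

Section Affine.
Context {R : realType}.
Implicit Types V W X : normedModType R.

Lemma second_difference_on_balls_comp_affine V W X (f : W -> X) (g : V -> W)
    (l : {linear V -> W}) (L : R) :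
  0 <= L -> (forall a, `|l a| <= L * `|a|) ->
  (forall a d, g (a + d) = g a + l d) ->
  second_difference_on_balls f -> second_difference_on_balls (f \o g).
Proof.
move=> L0 lL gl fs r.
have [C C0 fC] := fs (`|g 0| + L * `|r|).
exists (C * L ^+ 2) => [|a d ar dr]; first by rewrite mulr_ge0 ?sqr_ge0.
have Lr u : `|u| <= r -> `|l u| <= L * `|r|.
  move=> ur; apply: le_trans (lL _) _; rewrite ler_wpM2l//.
  exact: le_trans ur (ler_norm _).
rewrite /= !gl linearN; apply: le_trans (fC _ _ _ _) _.
- rewrite -[a]add0r gl (le_trans (ler_normD _ _))// lerD2l; exact: Lr.
- by rewrite ler_wpDl// Lr.
by rewrite -mulrA ler_wpM2l// -exprMn ler_sqr ?nnegrE// mulr_ge0.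
Qed.

End Affine.

(** * The lifting map and the error norm in reduced coordinates *)

Section Rom.
Context {R : realType} {NV NE : nat} (S : rom R NV NE).

Lemma rstate_coordinates : finite_coordinates (rstate R S).
Proof.
by apply: prod_coordinates; [apply: prod_coordinates|]; exact: mx_coordinates.
Qed.

Lemma state_coordinates : finite_coordinates (state R NV NE).
Proof.
by apply: prod_coordinates; [apply: prod_coordinates|]; exact: mx_coordinates.
Qed.

Definition lift_linear (y : rstate R S) : state R NV NE :=
  (Phiv S *m y.1.1, Phie S *m y.1.2, Phix S *m y.2).

Lemma lift_linear_is_linear : linear lift_linear.
Proof.
move=> k [[a b] c] [[a' b'] c']; rewrite /lift_linear /=.
by rewrite !mulmxDr -!scalemxAr.
Qed.

HB.instance Definition _ :=
  GRing.isLinear.Build R (rstate R S) (state R NV NE) _ lift_linear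
    lift_linear_is_linear.

Lemma liftD (y d : rstate R S) : lift (y + d) = lift y + lift_linear d.
Proof.
by rewrite /lift /lift_v /lift_linear /= !mulmxDr !addrA.
Qed.

Lemma liftB (y z : rstate R S) : lift y - lift z = lift_linear (y - z).
Proof. by rewrite -[y in lift y](subrK z) [_ + z]addrC liftD addrC addKr. Qed.

Lemma lift_linear_bounded : exists2 L : R, 0 <= L &
  forall y, `|lift_linear y| <= L * `|y|.
Proof.
exists ((nv S)%:R * `|Phiv S| + (ne S)%:R * `|Phie S| + (nx S)%:R * `|Phix S|).
  by rewrite !addr_ge0// mulr_ge0.
move=> [[a b] c]; set y : rstate R S := (a, b, c).
have [ya yb yc] : [/\ `|a| <= `|y|, `|b| <= `|y| & `|c| <= `|y|].
  by rewrite !prod_normE /= !le_max !lexx /= ?orbT.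
rewrite {1}[`|lift_linear y|]prod_normE {1}[`|(lift_linear y).1|]prod_normE.
have bd m n (Phi : 'M[R]_(m, n)) (u : 'cV[R]_n) : `|u| <= `|y| ->
    `|Phi *m u| <= n%:R * `|Phi| * `|y|.
  by move=> uy; rewrite (le_trans (mulmx_linear_bounded _ _))// ler_wpM2l// mulr_ge0.
rewrite !ge_max !mulrDl /=; apply/andP; split; first (apply/andP; split).
- by rewrite (le_trans (bd _ _ _ _ ya))// -addrA lerDl addr_ge0// !mulr_ge0.
- by rewrite (le_trans (bd _ _ _ _ yb))// addrAC lerDr addr_ge0// !mulr_ge0.
- by rewrite (le_trans (bd _ _ _ _ yc))// lerDr addr_ge0// !mulr_ge0.
Qed.

Definition state_form (w w' : state R NV NE) : R :=
  (w.1.1^T *m MV S *m w'.1.1) 0 0 + (w.1.2^T *m ME S *m w'.1.2) 0 0 +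
  (w.2^T *m w'.2) 0 0.

Lemma state_formE w : triple_norm S w = Num.sqrt (state_form w w).
Proof.
rewrite /triple_norm /mass_norm /euclid_norm /state_form !sqr_sqrtr.
- congr (Num.sqrt (_ + _)); rewrite mxE; apply: eq_bigr => i _.
  by rewrite mxE expr2.
- by apply: sumr_ge0 => i _; exact: sqr_ge0.
- exact: spd_ge0 (ME_spd S).
- exact: spd_ge0 (MV_spd S).
Qed.

Lemma state_form_ge0 w : 0 <= state_form w w.
Proof.
rewrite !addr_ge0//; first exact: spd_ge0 (MV_spd S).
  exact: spd_ge0 (ME_spd S).
by rewrite mxE; apply: sumr_ge0 => i _; rewrite mxE -expr2 sqr_ge0.
Qed.

Lemma state_form_sym w w' : state_form w w' = state_form w' w.
Proof.
have sw n (u u' : 'cV[R]_n) (M : 'M[R]_n) : M^T = M ->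
    (u^T *m M *m u') 0 0 = (u'^T *m M *m u) 0 0.
  move=> MT; have -> : (u^T *m M *m u') 0 0 = (u^T *m M *m u')^T 0 0.
    by rewrite [RHS]mxE.
  by rewrite !trmx_mul trmxK MT mulmxA.
rewrite /state_form; congr (_ + _ + _).
- by apply: sw; case: (MV_spd S).
- by apply: sw; case: (ME_spd S).
rewrite !mxE; apply: eq_bigr => i _.
by rewrite !mxE mulrC.
Qed.

Lemma state_formDl a b c : state_form (a + b) c = state_form a c + state_form b c.
Proof.
rewrite /state_form /= !linearD /= !mulmxDl !mxE. 
by rewrite [RHS]addrACA [X in X + _ = _]addrACA.
Qed.

Lemma state_formZl k a b : state_form (k *: a) b = k * state_form a b.
Proof.
by rewrite /state_form /= !linearZ /= -!scalemxAl !mxE !mulrDr.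
Qed.

Lemma triple_normD a b : triple_norm S (a + b) <= triple_norm S a + triple_norm S b.
Proof.
rewrite !state_formE; apply: psd_form_triangle.
- exact: state_form_sym.
- exact: state_formDl.
- exact: state_formZl.
- exact: state_form_ge0.
Qed.

Lemma triple_normZ k a : triple_norm S (k *: a) = `|k| * triple_norm S a.
Proof.
rewrite !state_formE state_formZl state_form_sym state_formZl mulrA -expr2.
by rewrite sqrtrM ?sqr_ge0// sqrtr_sqr.
Qed.

Lemma triple_norm_eq0 w : triple_norm S w = 0 -> w = 0.
Proof.
case: w => [[a b] c]; rewrite state_formE => /eqP.
rewrite sqrtr_eq0 /state_form /= => w0.
have a0 := spd_ge0 a (MV_spd S); have b0 := spd_ge0 b (ME_spd S).
have c0 : 0 <= (c^T *m c) 0 0.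
  by rewrite mxE; apply: sumr_ge0 => i _; rewrite mxE -expr2 sqr_ge0.
have pos n (M : 'M[R]_n) (u : 'cV[R]_n) : spd M -> (u^T *m M *m u) 0 0 <= 0 -> u = 0.
  move=> [_ Mpos] uM; apply/eqP; apply: contraTT uM => u0.
  by rewrite -ltNge Mpos.
congr (_, _, _).
- by apply: pos (MV_spd S) _; lra.
- by apply: pos (ME_spd S) _; lra.
have /eqP : (c^T *m c) 0 0 = 0 by lra.
rewrite mxE psumr_eq0 => [/allP c2|i _]; last by rewrite mxE -expr2 sqr_ge0.
apply/colP => i; rewrite [RHS]mxE.
have := c2 i (mem_index_enum i).
by rewrite mxE -expr2 sqrf_eq0 => /eqP.
Qed.

(** Offsets cancel in differences, so on a difference of reduced states this is exactly the norm of
    the lifted error. *)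
Definition rom_norm (y : rstate R S) : R := triple_norm S (lift_linear y).

Lemma rom_normD a b : rom_norm (a + b) <= rom_norm a + rom_norm b.
Proof. by rewrite /rom_norm linearD triple_normD. Qed.

Lemma rom_normZ k a : rom_norm (k *: a) = `|k| * rom_norm a.
Proof. by rewrite /rom_norm linearZ triple_normZ. Qed.

(** Definiteness comes from the orthonormal columns, which make each basis matrix injective. *)
Lemma rom_norm_equivalence : exists C : R, [/\ 0 < C,
  forall y, rom_norm y <= C * `|y| & forall y, `|y| <= C * rom_norm y].
Proof.
apply: seminorm_equivalence.
- exact: rstate_coordinates.
- exact: rom_normD.
- exact: rom_normZ.
move=> [[a b] c] /triple_norm_eq0[/= va eb xc].
have inj m n (Phi : 'M[R]_(m, n)) (u : 'cV[R]_n) : Phi^T *m Phi = 1%:M ->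
    Phi *m u = 0 -> u = 0.
  by move=> PhiI Phiu; rewrite -[u]mul1mx -PhiI -mulmxA Phiu mulmx0.
congr (_, _, _).
- exact: inj (Phiv_orth S) va.
- exact: inj (Phie_orth S) eb.
- exact: inj (Phix_orth S) xc.
Qed.

End Rom.

Section Pairs.
Context {R : realType}.
Implicit Types V W : normedModType R.

Lemma is_derive_pair V W (f : R -> V) (g : R -> W) (t : R) df dg :
  is_derive t 1 f df -> is_derive t 1 g dg ->
  is_derive t 1 (fun s => (f s, g s)) (df, dg).
Proof.
move=> [fd fE] [gd gE].
have H : (fun h : R => h^-1 *: (((fun s => (f s, g s)) \o shift t) (h *: 1) -
    (f t, g t))) @ 0^' --> (df, dg).
  rewrite -fE -gE; exact: cvg_pair fd gd.
split; first by apply/cvg_ex; exists (df, dg).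
exact: cvg_lim H.
Qed.

Lemma within_continuous_pair V W (A : set R) (f : R -> V) (g : R -> W) :
  {within A, continuous f} -> {within A, continuous g} ->
  {within A, continuous (fun s => (f s, g s))}.
Proof. by move=> fc gc x; apply: cvg_pair; [exact: fc|exact: gc]. Qed.

End Pairs.

(** * The reduced model and its scheme as an instance of the abstract step *)

Section RomSlope.
Context {R : realType} {NV NE : nat} (S : rom R NV NE).
Variable (F : state R NV NE -> 'M[R]_(NV, NE)).
Hypothesis F_C2 : class_C 2 F.

Definition velocity (y : rstate R S) : 'cV[R]_(nv S) := y.1.1.

Lemma velocity_is_linear : linear velocity.
Proof. by []. Qed.

HB.instance Definition _ :=
  GRing.isLinear.Build R (rstate R S) 'cV[R]_(nv S) _ velocity
    velocity_is_linear.

Lemma velocity_norm y : `|velocity y| <= `|y|.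
Proof. by rewrite !prod_normE /= !le_max lexx. Qed.

Definition momentum_mx : 'M[R]_(nv S, NV) :=
  invmx (rMV S) *m (Phiv S)^T *m PF1 S.

Definition energy_mx : 'M[R]_(ne S, NE) :=
  invmx (rME S) *m (Phie S)^T *m PFtv S.

Definition rom_force (p : rstate R S * 'cV[R]_(nv S)) : rstate R S :=
  (- (momentum_mx *m (F (lift p.1) *m const_mx 1)),
   energy_mx *m ((F (lift p.1))^T *m lift_v p.2),
   (Phix S)^T *m lift_v p.2).

Definition rom_field : rstate R S -> rstate R S := vector_field velocity rom_force.

Definition rom_slope : rstate R S * R^o -> rstate R S :=
  slope velocity rom_force.

Lemma rom_slope0 y : rom_slope (y, 0) = rom_field y.
Proof. exact: slope0. Qed.

(** The one identity to check is that averaging lifted velocities lifts the averaged one: the lift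
    is affine and the two weights sum to 1. *)
Lemma rk2_stepE dt y : rk2_step F dt y = y + dt *: rom_slope (y, dt).
Proof.
case: y => [[v e] x]; set y : rstate R S := (v, e, x).
have meanE (a b : 'cV[R]_(nv S)) : 2^-1 *: (lift_v a + lift_v (a - dt *: b)) =
    lift_v (a + (dt / 2) *: - b).
  rewrite /lift_v mulmxBr mulmxDr -!scalemxAr mulmxN !addrA.
  set p := vos S; set q := _ *m a; set s := _ *m b.
  have -> : p + q + p + q - dt *: s = 2 *: (p + q) - dt *: s.
    by rewrite scaler_nat mulr2n !addrA.
  rewrite scalerBr !scalerA mulVf ?pnatr_eq0// scale1r scalerN.
  by rewrite (mulrC dt).
have half : lift_v (v - (dt / 2) *: (momentum_mx *m (F (lift y) *m const_mx 1))) =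
    lift_v (half_velocity velocity rom_force (y, dt)).
  by rewrite /half_velocity /vector_field /velocity /= scalerN.
have halfE : (v - (dt / 2) *: (momentum_mx *m (F (lift y) *m const_mx 1)),
   e + (dt / 2) *: (energy_mx *m ((F (lift y))^T *m
      lift_v (half_velocity velocity rom_force (y, dt)))),
   x + (dt / 2) *: ((Phix S)^T *m
      lift_v (half_velocity velocity rom_force (y, dt)))) =
   half_state velocity rom_force (y, dt).
  rewrite /half_state /rom_force /=.
  by rewrite -scalerN.
rewrite /rk2_step /=.
rewrite -/momentum_mx -/energy_mx half halfE meanE.
set hs := half_state _ _ _.
have -> : lift_v (v + (dt / 2) *: - (momentum_mx *m (F (lift hs) *m const_mx 1))) =
  lift_v (mean_velocity velocity rom_force (y, dt)) by [].
rewrite /rom_slope /slope -/hs; move: hs (mean_velocity _ _ _) => hs ms.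
by rewrite -scalerN.
Qed.

Lemma lipschitz_on_balls_force_mx : lipschitz_on_balls F.
Proof.
apply: class_C1_lipschitz (class_CS F_C2); first exact: state_coordinates.
exact: mx_coordinates.
Qed.

Lemma lipschitz_on_balls_lift : lipschitz_on_balls (@lift R NV NE S).
Proof.
have [L L0 HL] := lift_linear_bounded S.
by apply: (lipschitz_on_balls_global L0) => a b; rewrite liftB.
Qed.

Lemma lipschitz_on_balls_lift_v : lipschitz_on_balls (@lift_v R NV NE S).
Proof.
apply: (@lipschitz_on_balls_global _ _ _ _ ((nv S)%:R * `|Phiv S|)).
  by rewrite mulr_ge0.
move=> a b; rewrite /lift_v opprD addrACA subrr add0r -mulmxBr.
exact: mulmx_linear_bounded.
Qed.

Lemma lipschitz_on_balls_mulmx (V : normedModType R) m n p (A : 'M[R]_(m, n))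
    (f : V -> 'M[R]_(n, p)) :
  lipschitz_on_balls f -> lipschitz_on_balls (fun a => A *m f a).
Proof.
apply: lipschitz_on_balls_comp.
apply: lipschitz_on_balls_linear (mulmx_linear_bounded A).
by rewrite mulr_ge0.
Qed.

Lemma lipschitz_on_balls_rom_force : lipschitz_on_balls rom_force.
Proof.
have Fl : lipschitz_on_balls
    (fun p : rstate R S * 'cV[R]_(nv S) => F (lift p.1)).
  apply: lipschitz_on_balls_comp lipschitz_on_balls_force_mx _.
  exact: lipschitz_on_balls_comp lipschitz_on_balls_lift
    (@lipschitz_on_balls_fst _ _ _).
have ul : lipschitz_on_balls
    (fun p : rstate R S * 'cV[R]_(nv S) => lift_v p.2).
  exact: lipschitz_on_balls_comp lipschitz_on_balls_lift_v
    (@lipschitz_on_balls_snd _ _ _).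
apply: lipschitz_on_balls_pair; last exact: lipschitz_on_balls_mulmx.
apply: lipschitz_on_balls_pair.
  apply/lipschitz_on_ballsN/lipschitz_on_balls_mulmx.
  apply: (lipschitz_on_balls_bilinear (mulmx_bilinear_bounded _ _ _)) => //.
  exact: lipschitz_on_balls_cst.
apply: lipschitz_on_balls_mulmx.
apply: (lipschitz_on_balls_bilinear (mulmx_bilinear_bounded _ _ _)) => //.
apply: lipschitz_on_balls_comp Fl.
exact: lipschitz_on_balls_linear (@trmx_linear_bounded _ _ _).
Qed.

Lemma second_difference_on_balls_mulmx (V : normedModType R) m n p (A : 'M[R]_(m, n))
    (f : V -> 'M[R]_(n, p)) :
  second_difference_on_balls f -> second_difference_on_balls (fun a => A *m f a).
Proof.
apply: second_difference_on_balls_linear (mulmx_linear_bounded A).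
by rewrite mulr_ge0.
Qed.

(** The field is a map of the full state precomposed with the affine lift. That map is built from
    [F] by linear maps and by one bilinear product, of the transpose of [F] with the velocity. *)
Lemma second_difference_on_balls_field :
  second_difference_on_balls rom_field.
Proof.
pose g (w : state R NV NE) : rstate R S :=
  ((- momentum_mx) *m F1 F w, energy_mx *m Ftv F w, (Phix S)^T *m w.1.1).
have -> : rom_field = g \o @lift R NV NE S.
  by apply/funext => y; rewrite /g /= mulNmx.
have [L L0 HL] := lift_linear_bounded S.
apply: (second_difference_on_balls_comp_affine L0 HL); first exact: liftD.
have Fs : second_difference_on_balls F.
  apply: class_C2_second_difference => //; first exact: state_coordinates.
  exact: mx_coordinates.
have vs : second_difference_on_balls (fun w : state R NV NE => w.1.1).
  apply: (@second_difference_on_balls_global _ _ _ _ 0) => // a d.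
  by rewrite /= addrACA subrr addr0 -mulr2n scaler_nat subrr normr0 mul0r.
have vl : lipschitz_on_balls (fun w : state R NV NE => w.1.1).
  exact: lipschitz_on_balls_comp (@lipschitz_on_balls_fst _ _ _)
    (@lipschitz_on_balls_fst _ _ _).
apply: second_difference_on_balls_pair; last exact: second_difference_on_balls_mulmx.
apply: second_difference_on_balls_pair; apply: second_difference_on_balls_mulmx.
  apply: second_difference_on_balls_linear (mulmxr_linear_bounded (const_mx 1)) Fs.
  by rewrite mulr_ge0.
apply: (second_difference_on_balls_bilinear (mulmx_bilinear_bounded _ _ _)) => //.
  apply: lipschitz_on_balls_comp lipschitz_on_balls_force_mx.
  exact: lipschitz_on_balls_linear (@trmx_linear_bounded _ _ _).
exact: second_difference_on_balls_linear (@trmx_linear_bounded _ _ _) Fs.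
Qed.

(** On the graph of the velocity map the force is paired with the velocity of its own state, so [F]
    enters only through [F1] and [Ftv], whose bounds are global. *)
Lemma field_lipschitz (K1 K2 : R) : 0 < K1 -> 0 < K2 ->
  (forall w w', euclid_norm (F1 F w - F1 F w') <= K1 * triple_norm S (w - w')) ->
  (forall w w', euclid_norm (Ftv F w - Ftv F w') <= K2 * triple_norm S (w - w')) ->
  exists2 L, 0 <= L & forall a b,
    `|rom_field a - rom_field b| <= L * rom_norm (a - b).
Proof.
move=> K1_gt0 K2_gt0 F1_lip Ftv_lip.
have [C [C0 _ normC]] := rom_norm_equivalence S.
pose c1 := NV%:R * `|momentum_mx| * K1.
pose c2 := NE%:R * `|energy_mx| * K2.
(* The position component is affine in the velocity, which the equivalence constant [C] bounds by
   the error norm. *)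
pose c3 := NV%:R * `|(Phix S)^T| * ((nv S)%:R * `|Phiv S| * C).
have c10 : 0 <= c1 by rewrite !mulr_ge0// ltW.
have c20 : 0 <= c2 by rewrite !mulr_ge0// ltW.
have c30 : 0 <= c3 by rewrite !mulr_ge0// ltW.
exists (c1 + c2 + c3) => [|a b]; first by rewrite !addr_ge0.
have N0 : 0 <= rom_norm (a - b) by exact: sqrtr_ge0.
rewrite /rom_field /vector_field /rom_force.
rewrite {1}[`|_ - _|]prod_normE {1}[`|(_ - _).1|]prod_normE /=.
rewrite !ge_max !mulrDl; apply/andP; split; first (apply/andP; split).
- rewrite -opprD normrN -mulmxBr.
  apply: (@le_trans _ _ (c1 * rom_norm (a - b))); last first.
    by rewrite -addrA lerDl addr_ge0// mulr_ge0.
  apply: le_trans (mulmx_linear_bounded _ _) _.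
  rewrite -(mulrA _ K1) ler_wpM2l ?mulr_ge0// /rom_norm -liftB.
  exact: le_trans (norm_le_euclid _) (F1_lip _ _).
- rewrite -mulmxBr.
  apply: (@le_trans _ _ (c2 * rom_norm (a - b))); last first.
    by rewrite addrAC lerDr addr_ge0// mulr_ge0.
  apply: le_trans (mulmx_linear_bounded _ _) _.
  rewrite -(mulrA _ K2) ler_wpM2l ?mulr_ge0// /rom_norm -liftB.
  exact: le_trans (norm_le_euclid _) (Ftv_lip _ _).
rewrite -mulmxBr; apply: (@le_trans _ _ (c3 * rom_norm (a - b))); last first.
  by rewrite lerDr addr_ge0// mulr_ge0.
apply: le_trans (mulmx_linear_bounded _ _) _.
rewrite -(mulrA (_ * _)) ler_wpM2l ?mulr_ge0//.
rewrite /lift_v opprD addrACA subrr add0r -mulmxBr.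
apply: le_trans (mulmx_linear_bounded _ _) _.
rewrite -(mulrA _ C) ler_wpM2l ?mulr_ge0//.
by apply: le_trans (normC _); exact: (velocity_norm (a - b)).
Qed.

End RomSlope.

(* C0 and h0 are chosen before the grid and before the discrete initial value
   (which ranges over an arbitrarily large ball around the exact one): C is one
   and the same constant C0 for all grids with maximal step at most h0. *)
Theorem theorem5p3 (R : realType) (NV NE : nat) (S : rom R NV NE)
  (F : state R NV NE -> 'M[R]_(NV, NE)) (tf K1 K2 K3 K4 : R)
  (v : R -> 'cV[R]_(nv S)) (e : R -> 'cV[R]_(ne S)) (x : R -> 'cV[R]_(nx S))
  (tf_gt0 : 0 < tf) (F_C2 : class_C 2 F)
  (K1_gt0 : 0 < K1) (K2_gt0 : 0 < K2) (K3_gt0 : 0 < K3) (K4_gt0 : 0 < K4)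
  (F1_lip : forall w w' : state R NV NE,
     euclid_norm (F1 F w - F1 F w') <= K1 * triple_norm S (w - w'))
  (Ftv_lip : forall w w' : state R NV NE,
     euclid_norm (Ftv F w - Ftv F w') <= K2 * triple_norm S (w - w'))
  (JF1_lip : forall w w' : state R NV NE,
     euclid_norm ('d (F1 F) w (lifted_Euler S F w)
                  - 'd (F1 F) w' (lifted_Euler S F w'))
     <= K3 * triple_norm S (w - w'))
  (JFtv_lip : forall w w' : state R NV NE,
     euclid_norm ('d (Ftv F) w (lifted_Euler S F w)
                  - 'd (Ftv F) w' (lifted_Euler S F w'))
     <= K4 * triple_norm S (w - w'))
  (sol : rom_solution F tf v e x) (r : R) :
  exists C0 h0 : R, 0 < C0 /\ 0 < h0 /\
    forall (N : nat) (t : nat -> R), temporal_grid tf N t ->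
    exists C : R, 0 < C /\ (max_step N t <= h0 -> C = C0) /\
      forall y0 : rstate R S,
        triple_norm S (rom_error F v e x t y0 0) <= r ->
        forall n : nat, (n <= N)%N ->
          triple_norm S (rom_error F v e x t y0 n) <=
            expR (C * t n) *
              (triple_norm S (rom_error F v e x t y0 0)
               + C * max_step N t ^+ 2).
Proof.
pose y (t : R) : rstate R S := (v t, e t, x t).
have G_lip := lipschitz_on_balls_rom_force S F_C2.
have [vc ec xc ode] := sol.
have yc : {within `[0, tf], continuous y}.
  by apply: within_continuous_pair => //; exact: within_continuous_pair.
have yd t : 0 < t < tf -> is_derive t 1 y (rom_field F (y t)).
  move=> t_int; have [[vd ed xd] [vE eE xE]] := ode t t_int.
  (* Invertible reduced mass matrices allow the model to be solved for the derivatives. *)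
  have MVu : rMV S \in unitmx by exact: spd_reduced_unit (MV_spd S) (Phiv_orth S).
  have MEu : rME S \in unitmx by exact: spd_reduced_unit (ME_spd S) (Phie_orth S).
  apply: is_derive_pair; first apply: is_derive_pair.
  - split=> //; rewrite -derive1E -[LHS](mulKmx MVu) vE mulmxN /momentum_mx.
    by rewrite !mulmxA.
  - split=> //; rewrite -derive1E -[LHS](mulKmx MEu) eE /energy_mx.
    by rewrite !mulmxA.
  - by split=> //; rewrite -derive1E xE.
have [Ct Ct0 trunc] := local_truncation (@velocity_norm _ _ _ S) G_lip
  (rstate_coordinates S)
  (second_difference_on_balls_field S F_C2) tf_gt0 yc yd.
have [B B0 yB] := solution_bounded yc.
have [Cn [Cn0 N_le norm_le]] := rom_norm_equivalence S.
have [L L0 fL] := field_lipschitz K1_gt0 K2_gt0 F1_lip Ftv_lip.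
(* At step size 0 the slope is the field, whose Lipschitz bound is global. *)
have NfL (a b : rstate R S) : rom_norm (rom_slope F (a, 0) -
    rom_slope F (b, 0)) <= Cn * L * rom_norm (a - b).
  by rewrite !rom_slope0 -mulrA (le_trans (N_le _))// ler_wpM2l// ltW.
have [C0 [h0 [C00 [h00 H]]]] := @one_step_error_bound R _ (@rom_norm R NV NE S)
  (@rom_slope R NV NE S F) tf y Cn (Cn * L) Ct B
  (@rom_normD _ _ _ S) (@rom_normZ _ _ _ S) N_le norm_le Cn0
  (lipschitz_on_balls_slope (@velocity_norm _ _ _ S) G_lip)
  (mulr_ge0 (ltW Cn0) L0) NfL tf_gt0 B0 yB Ct0 trunc r.
exists C0, h0; split=> //; split=> // N t grid.
have [C [C_gt0 [CE HC]]] := H N t grid.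
exists C; split=> //; split=> // y0.
have errE n : triple_norm S (rom_error F v e x t y0 n) =
    rom_norm (y (t n) - rk2_run F t y0 n) by rewrite /rom_error liftB.
rewrite errE => y0r n nN; rewrite !errE.
by apply: HC => // k; rewrite /= rk2_stepE.
Qed.
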